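(* Let $\tau:\mathbb{N}\to\mathbb{N}$ with $\tau(n)\ge n$ for all $n$ be such that the theory $T:=T_\tau$ is satisfiable. Then $T$ has quantifier elimination in the language $\mathcal{L}_{\mathrm{EX}}$ (with the new predicates interpreted by their defining formulas).
   Context: Pregeometries. A pregeometry $G$ on a (possibly infinite) set $M$ is a function $d=d_G$ from the finite subsets of $M$ to $\mathbb{N}$ such that $d(\emptyset)=0$, $d(A)\le d(A\cup\{x\})\le d(A)+1$, and $d(A\cup B)+d(A\cap B)\le d(A)+d(B)$. A finite $A$ is independent if $d(A)=|A|$; an arbitrary set is independent if all its finite subsets are; $d(Y)=\sup\{|Y_0|: Y_0\subseteq Y \text{ independent}\}$. For finite $A$, $\mathrm{cl}_G(A)=\{x: d(A\cup\{x\})=d(A)\}$, and $\mathrm{cl}_G(Y)=\bigcup\{\mathrm{cl}_G(Y_0): Y_0\subseteq Y\text{ finite}\}$. $Y$ is closed in $G$ if $\mathrm{cl}_G(Y)=Y$. A subpregeometry $H\subseteq G$ is the restriction of $d_G$ to subsets of a subset; subsets and subpregeometries are identified. For a finite collection $\Sigma=\{E_1,\dots,E_k\}$ of finite-dimensional closed sets of $G$ let $\Delta_G(\Sigma)=\sum_{\emptyset\ne s\subseteq\{1,\dots,k\}}(-1)^{|s|+1}d_G\left(\bigcap_{i\in s}E_i\right)$. $G$ is flat if $\Delta_G(\Sigma)\ge d_G(\bigcup\Sigma)$ for every such $\Sigma$. Embeddings. For $H\subseteq G$: $H\sqsubseteq^* G$ means $d_H(X_1\cap X_2)=d_G(\mathrm{cl}_G(X_1)\cap\mathrm{cl}_G(X_2))$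 for all $X_1,X_2$ closed in $H$. $H\sqsubseteq G$ means that for every finite collection $\Sigma$ of finite-dimensional closed sets of $G$, $\Delta_H(\{E\cap H: E\in\Sigma\})\le\Delta_G(\Sigma)$. $X\sqsubseteq^n G$ means: $X\sqsubseteq^* G$ and $X\sqsubseteq Y$ for every $Y$ with $X\subseteq Y\sqsubseteq^* G$ and $|Y\setminus X|\le n$. Language and theory. Pregeometries are structures in the language $\mathcal{L}=\{I_n:n\in\omega\}$, $I_n$ an $n$-ary relation symbol interpreted as the set of independent $n$-tuples. $\mathfrak{C}$ is the class of all finite flat pregeometries. For $\tau:\mathbb{N}\to\mathbb{N}$ with $\tau(n)\ge n$, $T_\tau$ is the $\mathcal{L}$-theory stating of the ambient structure $G$: (T1) $G$ is a flat pregeometry; (T2) $G$ is infinite-dimensional; (T3) for all finite $F\sqsubseteq^* G$, all $H\in\mathfrak{C}$ with $F\sqsubseteq H$, and all $n\in\mathbb{N}$: if $F\sqsubseteq^{\tau(|H|+n)}G$ then there is an embedding $f:H\to G$ fixing $F$ pointwise with $f[H]\sqsubseteq^n G$. The language $\mathcal{L}_{\mathrm{EX}}$. For a finite pregeometry $H$ and an enumeration $\bar h$ of its elements (as a tuple of distinct elements), $\Phi_H(\bar x)$ is a (finite) quantifier-free $\mathcal{L}$-formula isolating the full atomic type of $\bar h$ (so it says that $\bar x$ is a copy of $H$), and $\Phi^*_H(\bar x)$ is the universal $\mathcal{L}$-formula saying that $\Phi_H(\bar x)$ holds and $\bar x\sqsubseteq^* G$ in the ambient structure $G$; explicitly: $\Phi_H(\bar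 x)$ holds and for all $X_1,X_2\subseteq\bar x$, with $n=d(\mathrm{cl}_H(X_1)\cap\mathrm{cl}_H(X_2))+1$, every $y_1,\dots,y_n\in\mathrm{cl}_G(X_1)\cap\mathrm{cl}_G(X_2)$ are dependent. $\mathcal{L}_{\mathrm{EX}}$ is $\mathcal{L}$ enriched by a predicate symbol for each formula of the form $\exists\bar y\,\Phi^*_H(\bar x\bar y)$ with $H\in\mathfrak{C}$ (for each way of enumerating $H$ and splitting the enumeration as $\bar x\bar y$), interpreted in a pregeometry by that formula; every $\mathcal{L}_{\mathrm{EX}}$-theory is assumed to force this interpretation. *)

(* Defs.v *)
From mathcomp Require Import all_boot all_order all_algebra.
From mathcomp Require Import finmap.
From mathcomp Require Import mathcomp_extra boolp classical_sets functions.
From mathcomp Require Import cardinality.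

Set Implicit Arguments.
Unset Strict Implicit.
Unset Printing Implicit Defensive.

Import GRing.Theory Num.Theory.

Local Open Scope classical_set_scope.

(** Carriers are [choiceType]s only so that their finite subsets form the type
    [{fset M}]; classically every type carries a [choiceType] structure. *)

Section Pregeometries.
Variable M : choiceType.
Implicit Types (d : {fset M} -> nat) (A B : {fset M}) (G H X Y : set M).

Definition pregeometry d : Prop :=
  [/\ d fset0 = 0%N,
      forall A x, (d A <= d (x |` A)%fset <= (d A).+1)%N
    & forall A B, (d (A `|` B)%fset + d (A `&` B)%fset <= d A + d B)%N].

Definition independent d A : Prop := d A = #|` A|.

Definition has_dim d Y (n : nat) : Prop :=
  (exists A, [/\ [set` A] `<=` Y, independent d A & #|` A| = n]) /\
  (forall A, [set` A] `<=` Y -> independent d A -> (#|` A| <= n)%N).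

Definition finite_dim d Y : Prop := exists n, has_dim d Y n.

(** Relevant for finite-dimensional [Y] only (the default value is [0]). *)
Definition fdim d Y : nat := xget 0%N [set n | has_dim d Y n].

(** [None] stands for an infinite supremum. *)
Definition dim d Y : option nat :=
  if `[< finite_dim d Y >] then Some (fdim d Y) else None.

(** In what follows a set [G : set M] stands for the subpregeometry of [(M, d)]
    with underlying set [G]; [setT] is the whole pregeometry.  Dimensions do not
    depend on [G], but closures do. *)

Definition cl d G Y : set M :=
  [set x | G x /\ exists2 A, [set` A] `<=` Y & d (x |` A)%fset = d A].

Definition closed_in d G Y : Prop := Y `<=` G /\ cl d G Y = Y.

(** Finite collections are indexed families [E : 'I_k -> set M]; repeating a
    member does not change the alternating sum. *)
Definition Delta d k (E : 'I_k -> set M) : int :=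
  (\sum_(s : {set 'I_k} | s != finset.set0)
     (-1) ^+ #|s|.+1 * (fdim d (\bigcap_(i in [set j | j \in s]) E i))%:Z)%R.

Definition closed_family d G k (E : 'I_k -> set M) : Prop :=
  forall i, closed_in d G (E i) /\ finite_dim d (E i).

Definition flat d : Prop :=
  forall k (E : 'I_k -> set M), closed_family d setT E ->
    ((fdim d (\bigcup_i E i))%:Z <= Delta d E)%R.

(** [H] ⊑* [G] *)
Definition star_embedded d H G : Prop :=
  H `<=` G /\
  forall X1 X2, closed_in d H X1 -> closed_in d H X2 ->
    dim d (X1 `&` X2) = dim d (cl d G X1 `&` cl d G X2).

(** [H] ⊑ [G] *)
Definition strongly_embedded d H G : Prop :=
  H `<=` G /\
  forall k (E : 'I_k -> set M), closed_family d G E ->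
    (Delta d (fun i => E i `&` H) <= Delta d E)%R.

(** [X] ⊑^n [G] with [G] the whole pregeometry *)
Definition n_embedded d (n : nat) X : Prop :=
  star_embedded d X setT /\
  forall Y, X `<=` Y -> star_embedded d Y setT -> (Y `\` X #<= `I_n)%card ->
    strongly_embedded d X Y.

End Pregeometries.

Definition flat_pregeometry (M : choiceType) (d : {fset M} -> nat) : Prop :=
  pregeometry d /\ flat d.

Definition pg_embedding (M N : choiceType) (d : {fset M} -> nat)
    (e : {fset N} -> nat) (f : M -> N) : Prop :=
  injective f /\ forall A : {fset M}, e [fset f x | x in A]%fset = d A.

(** The pregeometry induced on the finite set [F], as a pregeometry on the type
    of elements of [F]. *)
Definition restr (M : choiceType) (d : {fset M} -> nat) (F : {fset M})
    (A : {fset F}) : nat := d [fset val x | x in A]%fset.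

(** First-order logic over relational signatures.  A formula of type
    [formula S n] has its free variables among x_0, ..., x_(n-1); [All] binds
    x_0 and shifts the other variables. *)

Record signature := Signature { symb : Type; arity : symb -> nat }.

Record structure (S : signature) := Structure {
  carrier :> choiceType;
  interp : forall r : symb S, (arity r).-tuple carrier -> Prop }.

Arguments interp {S} s r _.

Inductive formula (S : signature) : nat -> Type :=
| Eq n (i j : 'I_n) : formula S n
| Rel n (r : symb S) (t : (arity r).-tuple 'I_n) : formula S n
| Bot n : formula S n
| Imp n (f g : formula S n) : formula S n
| All n (f : formula S n.+1) : formula S n.

Fixpoint sat (S : signature) (N : structure S) n (f : formula S n) :
    n.-tuple N -> Prop :=
  match f in formula _ n return n.-tuple N -> Prop with
  | Eq _ i j => fun v => tnth v i = tnth v j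
  | Rel _ r t => fun v => interp N r [tuple of [seq tnth v i | i <- t]]
  | Bot _ => fun _ => False
  | Imp _ f g => fun v => sat f v -> sat g v
  | All _ f => fun v => forall x : N, sat f [tuple of x :: v]
  end.

Fixpoint quantifier_free (S : signature) n (f : formula S n) : bool :=
  match f with
  | Eq _ _ _ | Rel _ _ _ | Bot _ => true
  | Imp _ f g => quantifier_free f && quantifier_free g
  | All _ _ => false
  end.

Definition theory (S : signature) := set (formula S 0).

Definition model (S : signature) (T : theory S) (N : structure S) : Prop :=
  forall f, T f -> sat f ([tuple] : 0.-tuple N).

Definition satisfiable (S : signature) (T : theory S) : Prop :=
  exists N : structure S, model T N.

Definition quantifier_elimination (S : signature) (T : theory S) : Prop :=
  forall n (f : formula S n), exists2 g : formula S n, quantifier_free g &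
    forall N : structure S, model T N ->
    forall v : n.-tuple N, sat f v <-> sat g v.

(** The predicate symbols for the formulas ∃ȳ Φ*_H(x̄ȳ): the pregeometry [H],
    being enumerated, lives on ['I_(nx + ny)], with x̄ the first [nx] points. *)
Record ex_symb := ExSymb {
  ex_nx : nat;
  ex_ny : nat;
  ex_pg : {fset 'I_(ex_nx + ex_ny)} -> nat;
  ex_flat : flat_pregeometry ex_pg }.

(** [inl n] is the symbol I_n of the language of pregeometries. *)
Definition L_EX : signature := {|
  symb := (nat + ex_symb)%type;
  arity := fun r => match r with inl n => n | inr e => ex_nx e end |}.

Definition Phi_star (m : nat) (h : {fset 'I_m} -> nat) (M : choiceType)
    (d : {fset M} -> nat) (t : m.-tuple M) : Prop :=
  pg_embedding h d (tnth t) /\ star_embedded d [set x | x \in t] setT.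

(** A tuple is independent when its underlying set has dimension its length; so
    the entries of an independent tuple are distinct. *)
Definition EX_interpretation (N : structure L_EX) (d : {fset N} -> nat) :
    Prop :=
  (forall n (t : n.-tuple N), interp N (inl n) t <-> d [fset x in (t : seq N)]%fset = n) /\
  (forall e (t : (ex_nx e).-tuple N),
     interp N (inr e) t <->
     exists u : (ex_ny e).-tuple N, Phi_star (@ex_pg e) d [tuple of t ++ u]).

Section TheoryTau.
Variable tau : nat -> nat.

Definition extension_axiom (M : choiceType) (d : {fset M} -> nat) : Prop :=
  forall (F : {fset M}) (H : finType) (h : {fset H} -> nat) (i : F -> H)
         (n : nat),
    star_embedded d [set` F] setT ->
    flat_pregeometry h ->
    pg_embedding (restr d (F := F)) h i ->
    strongly_embedded h (range i) setT ->
    n_embedded d (tau (#|H| + n)) [set` F] ->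
    exists f : H -> M,
      [/\ pg_embedding h d f, forall x : F, f (i x) = val x
        & n_embedded d n (range f)].

Definition satisfies_T (N : structure L_EX) : Prop :=
  exists d : {fset N} -> nat,
    [/\ EX_interpretation d, flat_pregeometry d, ~ finite_dim d setT
      & extension_axiom d].

(** The first-order theory stating [satisfies_T], as a deductively closed set of
    sentences.  As the conditions in [satisfies_T] are first-order expressible,
    its models are the structures satisfying them. *)
Definition T_theory : theory L_EX :=
  [set f | forall N : structure L_EX, satisfies_T N ->
     sat f ([tuple] : 0.-tuple N)].

End TheoryTau.

(* Main.v *)
From mathcomp Require Import all_boot all_order all_algebra.
From mathcomp Require Import finmap zify.
From mathcomp Require Import mathcomp_extra boolp classical_sets functions.
From mathcomp Require Import cardinality.
Require Import Defs.

Set Implicit Arguments.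
Unset Strict Implicit.
Unset Printing Implicit Defensive.

Import Order.TTheory GRing.Theory Num.Theory.

Local Open Scope classical_set_scope.

(** Why the theory eliminates quantifiers.  [T_theory tau] is deductively closed,
    so an equivalence between two formulas holds in all its models as soon as it
    holds in the structures satisfying [satisfies_T tau].  Compactness is avoided
    by bounding every construction by a function of the sizes involved; there are
    two constructions.

    Back and forth.  By the extension axioms, an isomorphism between finite sets
    that are sufficiently n-embedded in two models extends to any n'-embedded
    finite superset of one of them.  Finite sets lie in n'-embedded ones of
    bounded size ([n_embedded_superset]), so the truth of a formula is preserved
    by isomorphisms between finite sets that are mu-embedded, where mu depends on
    the formula and on the size of the sets ([back_and_forth]).

    Choice of embedded sets.  The predicates of the language copy a star-embedded
    superset of a tuple from one model to another ([copy_star]), but they do not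
    see whether it is n-embedded.  To find a superset that is n-embedded on both
    sides ([selection]) one uses a rank of star-embedded sets, an isomorphism
    invariant with values in a well-order: a star-embedded set that is not
    n-embedded has a bounded superset of smaller rank ([star_descent]), so the
    descent stops after finitely many bounded steps, whichever model causes them
    ([bounded_descent]).

    The rank comes from the alternating sums [Delta].  These depend only on the
    down-set of closed sets generated by a family, and are modular in it
    ([Dl_eq], [Dl_cat]): as for a hypergraph, [Delta] counts points minus edges.
    Hence each member [G] of a finite family [L] of closed sets that is stable
    under intersections has a number [alpha L G] of edges that live on [G] and on
    no smaller member; by flatness it is non-negative if [G] is spanned by points
    of the family.  The rank counts these edges by dimension, the highest
    dimension being compared first.  If a star-embedded set [X] fails to be
    strongly embedded in a larger one, some closed set [G] of [X] contains closed
    sets of the larger one that account for edges on [G] ([tight_Dl_le]).  Adding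
    them to the family trades edges on [G] for edges of lower dimension
    ([resolve]).  The enlarged family need not be the lattice of closed sets of a
    star-embedded set; but if no two closed sets resolve a member of the family
    any further, the chosen spanning points are star-embedded ([tight_stable])
    and the closed sets that the family misses carry no edges
    ([alpha_closures_new]), so that the rank does not grow.  *)

(** * Closure and dimension in a pregeometry *)

Section Closure.
Variables (M : choiceType) (d : {fset M} -> nat).
Hypothesis pgd : pregeometry d.
Implicit Types (A B X : {fset M}) (E F Y Z : set M).
Local Notation c := (cl d setT).

Lemma dim_mono A B : (A `<=` B)%fset -> d A <= d B.
Proof.
move=> AB; have -> : B = (A `|` B)%fset by apply/esym/fsetUidPr.
elim/finSet_rect: B {AB} => B IH.
have [->|/fset0Pn[x xB]] := eqVneq B fset0; first by rewrite fsetU0.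
rewrite -(fsetD1K xB) fsetUCA.
have /IH/leq_trans : (B `\ x `<` B)%fset by rewrite fproperD1.
by apply; case: pgd => _ /(_ (A `|` B `\ x)%fset x)/andP[].
Qed.

Lemma dim_add_le A x : d (x |` A)%fset <= (d A).+1.
Proof. by case: pgd => _ /(_ A x)/andP[]. Qed.

Lemma dim_add_neq A x : d (x |` A)%fset <> d A -> d (x |` A)%fset = (d A).+1.
Proof.
move=> /eqP ne; apply/eqP; rewrite eqn_leq dim_add_le /= ltn_neqAle eq_sym ne.
exact/dim_mono/fsubsetU1.
Qed.

Lemma dim_card A : d A <= #|` A|.
Proof.
elim/finSet_rect: A => A IH.
have [->|/fset0Pn[x xA]] := eqVneq A fset0; first by case: pgd => ->.
rewrite -(fsetD1K xA) cardfsU1 !inE eqxx /= add1n.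
by rewrite (leq_trans (dim_add_le _ _))// ltnS IH// fproperD1.
Qed.

(** Submodularity: an element that adds nothing to [A] adds nothing to a larger
    set. *)
Lemma dim_add_sub A B x :
  (A `<=` B)%fset -> d (x |` A)%fset = d A -> d (x |` B)%fset = d B.
Proof.
move=> AB dA; apply/eqP; rewrite eqn_leq [X in _ && X]dim_mono ?fsubsetU1// andbT.
have [_ _ /(_ (x |` A)%fset B)] := pgd.
rewrite -fsetUA (fsetUidPr _ _ AB) dA => sub.
have : d A <= d ((x |` A) `&` B)%fset.
  by apply: dim_mono; rewrite fsubsetI AB andbT fsubsetU1.
by lia.
Qed.

Lemma dim_absorb A B :
  (forall x, x \in B -> d (x |` A)%fset = d A) -> d (A `|` B)%fset = d A.
Proof.
elim/finSet_rect: B => B IH AB.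
have [->|/fset0Pn[x xB]] := eqVneq B fset0; first by rewrite fsetU0.
rewrite -(fsetD1K xB) fsetUCA -[RHS](IH (B `\ x)%fset) ?fproperD1//; last first.
  by move=> y /fsetD1P[_ yB]; exact: AB.
by apply: (dim_add_sub (fsubsetUl _ _)); exact: AB.
Qed.

Lemma sub_cl Y : Y `<=` c Y.
Proof.
move=> x Yx; split=> //; exists [fset x]%fset; last by rewrite fsetUid.
by move=> y /=; rewrite inE => /eqP->.
Qed.

Lemma cl_mono Y Z : Y `<=` Z -> c Y `<=` c Z.
Proof. by move=> YZ x [_ [A AY Ax]]; split=> //; exists A => // y /AY/YZ. Qed.

Lemma cl_finE A x : c [set` A] x <-> d (x |` A)%fset = d A.
Proof.
split=> [[_ [B BA dB]]|dA]; last by split=> //; exists A.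
by apply: dim_add_sub dB; apply/fsubsetP => y /BA.
Qed.

(** Finitely many elements of a closure depend on one finite set; this is what
    makes the closure idempotent. *)
Lemma cl_common A Y : [set` A] `<=` c Y ->
  exists2 B : {fset M}, [set` B] `<=` Y & [set` A] `<=` c [set` B].
Proof.
elim/finSet_rect: A => A IH AY.
have [->|/fset0Pn[x xA]] := eqVneq A fset0.
  by exists fset0 => y; rewrite /= inE.
have [|B BY AB] := IH (A `\ x)%fset (fproperD1 xA).
  by move=> y /fsetD1P[_ /AY].
have [_ [C CY xC]] := AY x xA.
exists (B `|` C)%fset => [y /=|y /=]; first by rewrite inE => /orP[/BY|/CY].
have [->|yx] := eqVneq y x => yA; last first.
  have yB : [set` (A `\ x)%fset] y by rewrite /= !inE yx.
  by apply: cl_mono (AB _ yB) => z /= zB; rewrite inE zB.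
by apply/cl_finE; apply: dim_add_sub xC; exact: fsubsetUr.
Qed.

Lemma cl_idem Y : c (c Y) = c Y.
Proof.
apply/seteqP; split=> [x [_ [A AY xA]]|]; last exact: sub_cl.
have [B BY AB] := cl_common AY.
apply: (cl_mono BY); apply/cl_finE.
have BA : d (B `|` A)%fset = d B by apply: dim_absorb => y /AB/cl_finE.
apply/eqP; rewrite eqn_leq [X in _ && X]dim_mono ?fsubsetU1// andbT.
rewrite -[X in _ <= X]BA -(dim_add_sub (fsubsetUr B A) xA); apply: dim_mono.
by rewrite fsetUA fsubsetUl.
Qed.

Lemma cl_min Y Z : Y `<=` c Z -> c Y `<=` c Z.
Proof. by move=> /cl_mono; rewrite cl_idem. Qed.

Lemma dim_le_cl A B : [set` B] `<=` c [set` A] -> d B <= d A.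
Proof.
move=> BA; rewrite -(@dim_absorb A B); last by move=> x /BA/cl_finE.
exact/dim_mono/fsubsetUr.
Qed.

Lemma sub_basis A :
  exists B, [/\ (B `<=` A)%fset, independent d B, d B = d A &
    [set` A] `<=` c [set` B]].
Proof.
elim/finSet_rect: A => A IH.
have [->|/fset0Pn[x xA]] := eqVneq A fset0.
  exists fset0; split; rewrite ?fsub0set// /independent ?cardfs0//.
  by case: pgd.
have [B [BA iB dB AB]] := IH _ (fproperD1 xA).
have clA Z : [set` B] `<=` Z -> c Z x -> [set` A] `<=` c Z.
  move=> BZ Zx y /= yA; have [->//|yx] := eqVneq y x.
  by apply: cl_mono (AB y _) => //=; rewrite !inE yx.
have subA : (B `<=` A)%fset by apply: fsubset_trans BA (fsubD1set _ _).
have [dx|dx] := pselect (d (x |` B)%fset = d B).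
  exists B; split=> //; last by apply: clA => //; exact/cl_finE.
  by apply/eqP; rewrite eqn_leq dim_mono//= dim_le_cl//; apply: clA => //;
     exact/cl_finE.
have AxB : [set` A] `<=` c [set` (x |` B)%fset].
  apply: clA; first by move=> y /= yB; rewrite !inE yB orbT.
  by apply: sub_cl; rewrite /= !inE eqxx.
exists (x |` B)%fset; split=> //.
- by rewrite fsubUset fsub1set xA.
- rewrite /independent dim_add_neq// iB cardfsU1 (contra_notN _ dx)// => xB.
  by rewrite (fsetUidPr _ _ _)// fsub1set.
- apply/eqP; rewrite eqn_leq [X in _ && X]dim_le_cl// andbT dim_mono//.
  by rewrite fsubUset fsub1set xA.
Qed.

Lemma has_dim_spanned A Y :
  [set` A] `<=` Y -> Y `<=` c [set` A] -> has_dim d Y (d A).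
Proof.
move=> AY YA; split.
  have [B [/fsubsetP BA iB dB _]] := sub_basis A.
  by exists B; split=> [x /BA/AY//|//|]; rewrite -iB.
by move=> B BY iB; rewrite -iB dim_le_cl// => x /BY/YA.
Qed.

Lemma has_dim_uniq Y m n : has_dim d Y m -> has_dim d Y n -> m = n.
Proof.
move=> [[A [AY iA <-]] Am] [[B [BY iB <-]] Bn].
by apply/eqP; rewrite eqn_leq Bn// Am.
Qed.

Lemma fdimE A Y : [set` A] `<=` Y -> Y `<=` c [set` A] -> fdim d Y = d A.
Proof.
move=> AY YA; apply: has_dim_uniq (has_dim_spanned AY YA).
exact: (xgetPex (P := has_dim d Y) 0 (ex_intro _ _ (has_dim_spanned AY YA))).
Qed.

Lemma fdim_fset A : fdim d [set` A] = d A.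
Proof. by apply: fdimE => //; exact: sub_cl. Qed.

Lemma finite_dim_spanned A Y :
  [set` A] `<=` Y -> Y `<=` c [set` A] -> finite_dim d Y.
Proof. by move=> AY YA; exists (d A); exact: has_dim_spanned. Qed.

Lemma finite_dim_fset A : finite_dim d [set` A].
Proof. by apply: (@finite_dim_spanned A) => //; exact: sub_cl. Qed.

Lemma finite_dim_basis Y : finite_dim d Y ->
  exists A, [/\ [set` A] `<=` Y, Y `<=` c [set` A],
    fdim d Y = d A & #|` A| = d A].
Proof.
move=> [n [[A [AY iA An]] maxn]]; exists A.
have YA : Y `<=` c [set` A].
  move=> x Yx; apply/cl_finE; apply: contrapT => dx.
  have xA : x \notin A.
    by apply: contra_notN dx => xA; rewrite (fsetUidPr _ _ _)// fsub1set.
  suff : #|` x |` A|%fset <= n by rewrite cardfsU1 xA add1n An ltnn.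
  apply: maxn; last by rewrite /independent dim_add_neq// iA cardfsU1 xA.
  by move=> y /=; rewrite !inE => /orP[/eqP->|/AY].
by split=> //; exact: fdimE.
Qed.

(** A finite subset of largest dimension spans. *)
Lemma finite_dim_sub Y Z : Y `<=` Z -> finite_dim d Z -> finite_dim d Y.
Proof.
move=> YZ /finite_dim_basis[B [BZ ZB _ _]].
pose P n := `[< exists A, [set` A] `<=` Y /\ d A = n >].
have P0 : exists n, P n.
  by exists (d fset0); apply/asboolP; exists fset0; split=> // x; rewrite /= inE.
have Pb n : P n -> n <= d B.
  by move=> /asboolP[A [AY <-]]; apply: dim_le_cl => x /AY/YZ/ZB.
have [n /asboolP[A [AY dA]] maxn] := ex_maxnP P0 Pb.
apply: (@finite_dim_spanned A) => // x Yx; apply/cl_finE; apply: contrapT => dx.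
suff /maxn : P (d (x |` A)%fset) by rewrite dim_add_neq// dA ltnn.
apply/asboolP; exists (x |` A)%fset; split; last by rewrite dim_add_neq// dA.
by move=> y /=; rewrite !inE => /orP[/eqP->|/AY].
Qed.

Lemma finite_dim_cl Y : finite_dim d Y -> finite_dim d (c Y).
Proof.
move=> /finite_dim_basis[A [AY YA _ _]]; apply: (@finite_dim_spanned A).
  by move=> x /AY; exact: sub_cl.
exact: cl_min.
Qed.

Lemma fdim_cl Y : finite_dim d Y -> fdim d (c Y) = fdim d Y.
Proof.
move=> /finite_dim_basis[A [AY YA -> _]]; apply: fdimE.
  by move=> x /AY; exact: sub_cl.
exact: cl_min.
Qed.

Lemma finite_dimU Y Z : finite_dim d Y -> finite_dim d Z ->
  finite_dim d (Y `|` Z).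
Proof.
move=> /finite_dim_basis[A [AY YA _ _]] /finite_dim_basis[B [BZ ZB _ _]].
apply: (@finite_dim_spanned (A `|` B)%fset) => x /=.
  by rewrite inE => /orP[/AY|/BZ]; [left|right].
by move=> [/YA|/ZB]; apply: cl_mono => y /= yA; rewrite inE yA ?orbT.
Qed.

Lemma fdim_mono Y Z : finite_dim d Z -> Y `<=` Z -> fdim d Y <= fdim d Z.
Proof.
move=> fZ YZ; have fY := finite_dim_sub YZ fZ.
have [A [AY YA -> _]] := finite_dim_basis fY.
have [B [BZ ZB -> _]] := finite_dim_basis fZ.
by apply: dim_le_cl => x /AY/YZ/ZB.
Qed.

Lemma fdim_span Y Z :
  finite_dim d Z -> Y `<=` Z -> fdim d Z <= fdim d Y -> Z `<=` c Y.
Proof.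
move=> fZ YZ; have fY := finite_dim_sub YZ fZ.
have [A [AY YA -> _]] := finite_dim_basis fY => dZ x Zx.
apply: (cl_mono AY); apply/cl_finE; apply: contrapT => dx.
have AxZ : [set` (x |` A)%fset] `<=` Z.
  by move=> y /=; rewrite !inE => /orP[/eqP->//|/AY/YZ].
by move: (fdim_mono fZ AxZ); rewrite fdim_fset dim_add_neq//; lia.
Qed.

Lemma dimE Y : finite_dim d Y -> dim d Y = Some (fdim d Y).
Proof. by move=> fY; rewrite /dim; case: asboolP. Qed.

(** ** Closed sets of finite dimension *)

Definition cf E := c E = E /\ finite_dim d E.

Lemma cf_cl Y : finite_dim d Y -> cf (c Y).
Proof. by move=> fY; split; [exact: cl_idem|exact: finite_dim_cl]. Qed.

Lemma cl_sub E Y : c E = E -> Y `<=` E -> c Y `<=` E.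
Proof. by move=> cE YE; rewrite -cE; exact: cl_mono. Qed.

Lemma clI E F : c E = E -> c F = F -> c (E `&` F) = E `&` F.
Proof.
move=> cE cF; apply/seteqP; split; last exact: sub_cl.
by move=> x Ix; split; [rewrite -cE|rewrite -cF]; apply: cl_mono Ix => y [].
Qed.

Lemma cfI E F : cf E -> cf F -> cf (E `&` F).
Proof.
move=> [cE fE] [cF fF]; split; first exact: clI.
by apply: finite_dim_sub fE => x [].
Qed.

Lemma cf_eq E F : cf E -> cf F -> E `<=` F -> fdim d F <= fdim d E -> E = F.
Proof.
move=> [cE fE] [cF fF] EF dE; apply/seteqP; split=> //.
by rewrite -cE; exact: fdim_span.
Qed.

Lemma cf_lt E F : cf E -> cf F -> E `<=` F -> E <> F -> fdim d E < fdim d F.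
Proof.
by move=> cE cF EF ne; rewrite ltnNge; apply/negP => /(cf_eq cE cF EF).
Qed.

Definition spanned Y E := c (Y `&` E) = E.

Lemma spanned_closed Y E : spanned Y E -> c E = E.
Proof. by move=> <-; exact: cl_idem. Qed.

Lemma spanned_cf X E : spanned [set` X] E -> cf E.
Proof.
move=> sE; split; first exact: spanned_closed sE.
rewrite -sE; apply: finite_dim_cl.
by apply: finite_dim_sub (finite_dim_fset X) => x [].
Qed.

Lemma spanned_sub X X' E :
  [set` X] `<=` [set` X'] -> spanned [set` X] E -> spanned [set` X'] E.
Proof.
move=> XX' sE; apply/seteqP; split.
  by apply: (cl_sub (spanned_closed sE)) => x [].
by rewrite -[X in X `<=` _]sE; apply: cl_mono => x [/XX'].
Qed.

Lemma spanned_cl Y Z : Z `<=` Y -> spanned Y (c Z).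
Proof.
move=> ZY; apply/seteqP; split; first by apply: cl_min => x [].
by apply: cl_mono => x Zx; split; [exact: ZY|exact: sub_cl].
Qed.

Lemma spanned_min Y E Z : spanned Y E -> c Z = Z -> Y `&` E `<=` Z -> E `<=` Z.
Proof. by move=> sE cZ YZ; rewrite -sE; exact: cl_sub. Qed.

End Closure.

(** * The alternating sum of a list of closed sets *)

Section Moebius.
Local Open Scope ring_scope.

(** Moebius inversion: every function on a finite poset sums some weights over
    principal down-sets; [r] is any strictly increasing rank function. *)
Lemma moebius (T : eqType) (le : rel T) (r : T -> nat) (u : seq T)
    (f : T -> int) :
  uniq u -> reflexive le ->
  {in u &, forall x y, le y x -> y != x -> (r y < r x)%N} ->
  exists w : T -> int, {in u, forall x, f x = \sum_(y <- u | le y x) w y}.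
Proof.
move=> uu lexx ler.
suff [w Hw] : exists w : T -> int, {in u, forall x,
    (r x < (\max_(x <- u) r x).+1)%N -> f x = \sum_(y <- u | le y x) w y}.
  by exists w => x xu; apply: Hw => //; rewrite ltnS (big_rem _ xu) leq_maxl.
elim: (_.+1) => [|n [w Hw]]; first by exists (fun=> 0).
exists (fun x => if r x == n then
  f x - \sum_(y <- u | le y x && (y != x)) w y else w x) => x xu.
rewrite ltnS leq_eqVlt => /orP[/eqP xn|xn].
  rewrite big_mkcond (bigD1_seq x)//= lexx xn eqxx -big_mkcondr/=.
  under [X in _ = _ - X + _]eq_bigl do rewrite andbC.
  rewrite -[LHS]addr0 -[RHS]addrA; congr (_ + _).
  rewrite big_seq_cond [X in _ + X]big_seq_cond -sumrN -big_split/=.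
  rewrite big1// => y /andP[yu /andP[ne yx]].
  by rewrite ltn_eqF ?addNr// -xn ler.
rewrite (Hw x xu xn) big_seq_cond [RHS]big_seq_cond; apply: eq_bigr.
move=> y /andP[yu yx]; rewrite ltn_eqF//.
have [->//|ne] := eqVneq y x; exact: ltn_trans (ler _ _ xu yu yx ne) xn.
Qed.

(** Expand the product of the factors 1 - [P i]. *)
Lemma inclusion_exclusion k (P : pred 'I_k) :
  \sum_(s : {set 'I_k} | s != finset.set0)
    (-1) ^+ #|s|.+1 * [forall (i | i \in s), P i]%:R =
  [exists i, P i]%:R :> int.
Proof.
have := bigA_distr (1 : int) +%R (fun i : 'I_k => - (P i)%:R) (fun=> 1).
rewrite (bigD1 finset.set0)//= [X in _ = X + _]big1 => [|i _]; last by rewrite inE.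
move=> prodE.
have -> : \sum_(s : {set 'I_k} | s != finset.set0)
    (-1) ^+ #|s|.+1 * [forall (i | i \in s), P i]%:R =
    - (\prod_(i < k) (- (P i)%:R + 1) - 1) :> int.
  rewrite prodE addrAC subrr add0r -sumrN; apply: eq_bigr => s _.
  rewrite exprS mulN1r mulNr; congr (- _).
  rewrite -big_mkcond/= prodrN; congr (_ * _).
  case: forall_inP => [Ps|nP].
    by rewrite big1// => i /Ps->.
  apply/esym/eqP; rewrite prodf_seq_eq0; apply: contrapT => nh.
  apply: nP => i si; apply: contrapT => nPi; apply: nh; apply/hasP.
  by exists i; rewrite ?mem_index_enum// si /=; case: (P i) nPi.
case: existsP => [[i Pi]|nP].
  by rewrite (bigD1 i)//= Pi addNr mul0r sub0r opprK.
rewrite big1 ?subrr ?oppr0// => i _; case: (boolP (P i)) => [Pi|_].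
  by case: nP; exists i.
by rewrite oppr0 add0r.
Qed.

End Moebius.

Section Meets.
Variable M : choiceType.
Implicit Types (E F : set M) (s t u : seq (set M)).

(** All intersections of non-empty sublists. *)
Fixpoint meets s : seq (set M) :=
  if s is E :: s' then E :: meets s' ++ [seq E `&` F | F <- meets s'] else [::].

Lemma size_meets s : (size (meets s)).+1 = 2 ^ size s.
Proof. by elim: s => //= E s IH; rewrite size_cat size_map expnS -IH; lia. Qed.

Lemma sub_meets s : {subset s <= meets s}.
Proof.
elim: s => //= E s IH F; rewrite !inE mem_cat => /orP[->//|/IH->].
by rewrite orbT.
Qed.

Lemma meets_ind s (P : set M -> Prop) :
  (forall E, E \in s -> P E) -> (forall E F, P E -> P F -> P (E `&` F)) ->
  forall E, E \in meets s -> P E.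
Proof.
elim: s => //= E s IH Ps PI F.
have {}IH : forall G, G \in meets s -> P G.
  by apply: IH => // G Gs; apply: Ps; rewrite inE Gs orbT.
rewrite inE mem_cat => /or3P[/eqP->|/IH//|/mapP[G /IH PG ->]].
  by apply: Ps; rewrite mem_head.
by apply: PI => //; apply: Ps; rewrite mem_head.
Qed.

Definition meet_stable s := {in s &, forall E F, E `&` F \in s}.

Lemma meets_closed s : meet_stable (meets s).
Proof.
elim: s => //= E s IH A B.
have memE C : C \in meets s -> E `&` C \in E :: meets s ++ [seq E `&` F | F <- meets s].
  by move=> Cs; rewrite inE mem_cat map_f ?orbT.
have mem C : C \in meets s -> C \in E :: meets s ++ [seq E `&` F | F <- meets s].
  by move=> Cs; rewrite inE mem_cat Cs orbT.
rewrite in_cons mem_cat => /or3P[/eqP->|As|/mapP[A' As ->]];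
  rewrite in_cons mem_cat => /or3P[/eqP->|Bs|/mapP[B' Bs ->]].
- by rewrite setIid mem_head.
- exact: memE.
- by rewrite setIA setIid memE.
- by rewrite setIC memE.
- by apply/mem/IH.
- by rewrite setICA; apply/memE/IH.
- by rewrite setIC setIA setIid memE.
- by rewrite -setIA; apply/memE/IH.
- by rewrite setIACA setIid; apply/memE/IH.
Qed.

(** The intersection of the down-sets generated by [s] and [t] is generated by
    the pairwise intersections. *)
Definition meetl s t := [seq E `&` F | E <- s, F <- t].

(** Inclusion of the generated down-sets. *)
Definition dominated s t := forall E, E \in s -> exists2 F, F \in t & E `<=` F.

Lemma dominated_subset s t : {subset s <= t} -> dominated s t.
Proof. by move=> st E /st Et; exists E. Qed.

Lemma dominated_cat s t u : dominated s u -> dominated t u -> dominated (s ++ t) u.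
Proof. by move=> su tu E; rewrite mem_cat => /orP[/su|/tu]. Qed.

Lemma meetlP s t G : reflect
  (exists E F, [/\ E \in s, F \in t & G = E `&` F]) (G \in meetl s t).
Proof.
apply: (iffP allpairsP) => [[[E F] /= [Es Ft ->]]|[E [F [Es Ft ->]]]].
  by exists E, F.
by exists (E, F).
Qed.

Lemma mem_meetl s t E F : E \in s -> F \in t -> E `&` F \in meetl s t.
Proof. by move=> Es Ft; apply/meetlP; exists E, F. Qed.

End Meets.

Section AlternatingSum.
Variables (M : choiceType) (d : {fset M} -> nat).
Hypothesis pgd : pregeometry d.
Implicit Types (A B X : {fset M}) (E F Y Z : set M) (s t u : seq (set M)).
Local Notation c := (cl d setT).
Local Open Scope ring_scope.

Definition all_cf s := forall E, E \in s -> cf d E.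

Definition Dl s : int := Delta d (fun i : 'I_(size s) => nth set0 s i).

Lemma all_cf_cat s t : all_cf s -> all_cf t -> all_cf (s ++ t).
Proof. by move=> cs ct E; rewrite mem_cat => /orP[/cs|/ct]. Qed.

Lemma all_cf_meetl s t : all_cf s -> all_cf t -> all_cf (meetl s t).
Proof. by move=> cs ct E /meetlP[F [G [/cs cF /ct cG ->]]]; exact: cfI. Qed.

Lemma all_cf_meets s : all_cf s -> all_cf (meets s).
Proof. by move=> cs; apply: meets_ind => // E F; exact: cfI. Qed.

Lemma mem_bigcap u k (E : 'I_k -> set M) (s : {set 'I_k}) :
  meet_stable u -> (forall i, E i \in u) -> s != finset.set0 ->
  \bigcap_(i in [set j | j \in s]) E i \in u.
Proof.
move=> uI Eu.
have memP l i : exists2 F, F \in u & forall x,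
    F x <-> forall j, j \in i :: l -> E j x.
  elim: l i => [|j l IH] i.
    exists (E i) => // x; split=> [Eix j|]; first by rewrite inE => /eqP->.
    by apply; rewrite mem_head.
  have [F Fu FP] := IH j; exists (E i `&` F) => [|x]; first exact: uI.
  split=> [[Eix /FP Fx] k'|Ex].
    by rewrite inE => /orP[/eqP->//|/Fx].
  split; first by apply: Ex; rewrite mem_head.
  by apply/FP => k' k'l; apply: Ex; rewrite inE k'l orbT.
case/finset.set0Pn => i si.
have [F Fu FP] := memP (enum s) i; rewrite (_ : bigcap _ _ = F)//.
apply/seteqP; split=> x.
  move=> Ex; apply/FP => j; rewrite inE mem_enum => /orP[/eqP->|]; exact: Ex.
by move/FP => Ex j /= sj; apply: Ex; rewrite inE mem_enum sj orbT.
Qed.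

(** Weights [w] whose sums over principal down-sets are the dimensions turn
    [Delta] into a measure of down-sets: this is what makes [Dl] depend on the
    generated down-set only, and modular. *)
Lemma Delta_weights u : meet_stable u -> all_cf u -> uniq u ->
  exists w : set M -> int,
  forall k (E : 'I_k -> set M), (forall i, E i \in u) ->
    Delta d E = \sum_(F <- u | [exists i, `[< F `<=` E i >]]) w F.
Proof.
move=> uI cu uu.
have [|E F Eu Fu /asboolP FE /eqP ne|w Hw] := @moebius _
    (fun E F => `[< E `<=` F >]) (fdim d) u (fun E => (fdim d E)%:Z) uu.
- by move=> E; apply/asboolP.
- exact: (cf_lt pgd (cu _ Fu) (cu _ Eu)).
exists w => k E Eu; rewrite /Delta.
transitivity (\sum_(s : {set 'I_k} | s != finset.set0) \sum_(F <- u)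
    w F * ((-1) ^+ #|s|.+1 * [forall (i | i \in s), `[< F `<=` E i >]]%:R)).
  apply: eq_bigr => s s0; rewrite Hw; last exact: mem_bigcap.
  rewrite big_distrr [LHS]big_mkcond; apply: eq_bigr => F _ /=.
  have -> : `[< F `<=` \bigcap_(i in [set j | j \in s]) E i >] =
      [forall (i | i \in s), `[< F `<=` E i >]].
    apply/asboolP/forall_inP => [FE i si|FE x Fx i /= si].
      by apply/asboolP => x /FE; apply.
    by move/asboolP: (FE i si); apply.
  by case: forallP => _; rewrite ?mulr1 ?mulr0// mulrC.
rewrite exchange_big big_mkcond/= [RHS]big_mkcond; apply: eq_bigr => F _.
rewrite -big_distrr/= inclusion_exclusion.
by case: existsP => _; rewrite ?mulr1 ?mulr0.
Qed.

Lemma Dl_weights s : all_cf s ->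
  exists (u : seq (set M)) (w : set M -> int), {subset s <= u} /\
  meet_stable u /\ forall t, {subset t <= u} ->
    Dl t = \sum_(F <- u) w F *+ has (fun E => `[< F `<=` E >]) t.
Proof.
move=> cs; pose u := undup (meets s).
have uI : meet_stable u by move=> E F; rewrite !mem_undup; exact: meets_closed.
have [|w Hw] := Delta_weights uI _ (undup_uniq _).
  by move=> E; rewrite mem_undup; exact: all_cf_meets.
exists u, w; split; first by move=> E; rewrite mem_undup; exact: sub_meets.
split=> // t tu; rewrite /Dl Hw => [|i]; last exact/tu/mem_nth.
rewrite big_mkcond; apply: eq_bigr => F _; rewrite mulrb.
congr (if _ then _ else _); apply/existsP/(has_nthP set0) => [[i Fi]|[i it Fi]].
  by exists i.
by exists (Ordinal it).
Qed.

Lemma Dl_eq s t : all_cf s -> all_cf t ->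
  dominated s t -> dominated t s -> Dl s = Dl t.
Proof.
move=> cs ct st ts.
have [u [w [su [_ Hw]]]] := Dl_weights (all_cf_cat cs ct).
rewrite !Hw => [|E Et|E Es]; try by apply: su; rewrite mem_cat ?Et ?Es ?orbT.
apply: eq_bigr => F _; congr (_ *+ nat_of_bool _); apply/hasP/hasP => -[E Es /asboolP FE].
  by have [G Gt EG] := st E Es; exists G => //; apply/asboolP => x /FE/EG.
by have [G Gt EG] := ts E Es; exists G => //; apply/asboolP => x /FE/EG.
Qed.

(** [Dl] is modular: [s ++ t] and [meetl s t] generate the union and the
    intersection of the down-sets of [s] and [t]. *)
Lemma Dl_cat s t : all_cf s -> all_cf t ->
  Dl (s ++ t) = Dl s + Dl t - Dl (meetl s t).
Proof.
move=> cs ct.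
have [u [w [su [uI Hw]]]] := Dl_weights (all_cf_cat cs ct).
have sub_s : {subset s <= u} by move=> E Es; apply: su; rewrite mem_cat Es.
have sub_t : {subset t <= u} by move=> E Et; apply: su; rewrite mem_cat Et orbT.
rewrite !Hw//; last by move=> E /meetlP[F [G [/sub_s Fu /sub_t Gu ->]]]; exact: uI.
apply/eqP; rewrite eq_sym subr_eq eq_sym; apply/eqP.
rewrite -!big_split; apply: eq_bigr => F _ /=.
rewrite has_cat.
have -> : has (fun E => `[< F `<=` E >]) (meetl s t) =
    has (fun E => `[< F `<=` E >]) s && has (fun E => `[< F `<=` E >]) t.
  apply/hasP/andP => [[_ /meetlP[E [G [Es Gt ->]]] /asboolP FI]|].
    split; apply/hasP; [exists E|exists G] => //; apply/asboolP => x /FI[]//.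
  move=> [/hasP[E Es /asboolP FE] /hasP[G Gt /asboolP FG]].
  exists (E `&` G); first exact: mem_meetl.
  by apply/asboolP => x Fx; split; [exact: FE|exact: FG].
by do 2 case: has; rewrite /= ?mulr0n ?addr0 ?add0r.
Qed.

Lemma Dl1 E : cf d E -> Dl [:: E] = (fdim d E)%:Z.
Proof.
move=> cE; rewrite /Dl /Delta (bigD1 [set: 'I_1]%SET)/=; last first.
  by apply/finset.set0Pn; exists ord0; rewrite finset.in_setT.
rewrite finset.cardsT card_ord sqrrN expr1n mul1r big1 => [|s /andP[s0 sT]].
  rewrite addr0; congr (fdim d _)%:Z; apply/seteqP; split=> x.
    by move=> Ex; apply: (Ex ord0); rewrite /= finset.in_setT.
  by move=> Ex i _; rewrite ord1.
exfalso; move/finset.set0Pn: s0 => [i]; rewrite ord1 => si.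
by move/eqP: sT; apply; apply/setP => j; rewrite ord1 si inE.
Qed.

Lemma Dl_cat1 s E : all_cf s -> cf d E ->
  Dl (s ++ [:: E]) = Dl s + (fdim d E)%:Z - Dl (meetl s [:: E]).
Proof.
by move=> cs cE; rewrite Dl_cat// ?Dl1// => F; rewrite inE => /eqP->.
Qed.

End AlternatingSum.

(** * Frames and their resolutions *)

(** The lexicographic order in which the largest argument up to [D] counts most. *)
Definition lt_lex D (r r' : nat -> nat) :=
  exists s, [/\ s <= D, r s < r' s & forall t, s < t <= D -> r t = r' t].

Lemma sum_lt (T : eqType) (s : seq T) (P : pred T) (f g : T -> nat) x :
  x \in s -> P x -> f x < g x -> (forall y, y \in s -> P y -> f y <= g y) ->
  \sum_(y <- s | P y) f y < \sum_(y <- s | P y) g y.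
Proof.
move=> xs Px fgx fg; rewrite !(big_rem x xs) Px /= -addSn leq_add//.
rewrite big_seq_cond [leqRHS]big_seq_cond leq_sum// => y /andP[/mem_rem].
exact: fg.
Qed.

Section Frames.
Variables (M : choiceType) (d : {fset M} -> nat).
Hypotheses (pgd : pregeometry d) (fld : flat d).
Implicit Types (A B X : {fset M}) (E F G Y Z : set M).
Implicit Types (s t u L : seq (set M)).
Local Notation c := (cl d setT).
Local Open Scope ring_scope.

Lemma finite_dim_union s : all_cf d s ->
  finite_dim d [set x | exists2 E, E \in s & E x].
Proof.
elim: s => [|E s IH] cs.
  by apply: (finite_dim_sub pgd _ (finite_dim_fset pgd fset0)) => x [].
have cE : cf d E by apply: cs; rewrite mem_head.
have /IH fs : all_cf d s by move=> F Fs; apply: cs; rewrite inE Fs orbT.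
apply: (finite_dim_sub pgd _ (finite_dimU pgd cE.2 fs)) => x [F].
by rewrite inE => /orP[/eqP->|Fs Fx]; [left|right; exists F].
Qed.

Lemma flat_union s : all_cf d s ->
  (fdim d [set x | exists2 E, E \in s & E x])%:Z <= Dl d s.
Proof.
move=> cs; have /fld : closed_family d setT (fun i : 'I_(size s) => nth set0 s i).
  by move=> i; have [cE fE] := cs _ (mem_nth set0 (ltn_ord i)); split.
congr ((fdim d _)%:Z <= _); apply/seteqP; split=> x.
  by move=> [i _ ix]; exists (nth set0 s i) => //; exact: mem_nth.
move=> [E /(nthP set0)[i si <-] ix]; by exists (Ordinal si).
Qed.

(** The form in which flatness is used: it is enough that the family contains
    points that span. *)
Lemma fdim_le_Dl X E s : all_cf d s -> spanned d [set` X] E ->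
  (forall x, x \in X -> E x -> exists2 F, F \in s & F x) ->
  (fdim d E)%:Z <= Dl d s.
Proof.
move=> cs sE Xs; apply: le_trans (flat_union cs); rewrite lez_nat.
have fXE : finite_dim d ([set` X] `&` E).
  by apply: (finite_dim_sub pgd _ (finite_dim_fset pgd X)) => x [].
rewrite -[in X in (X <= _)%N]sE fdim_cl//; apply: fdim_mono => //.
  exact: finite_dim_union.
by move=> x [/= /Xs]; apply.
Qed.

Lemma Dl_ge0 s : all_cf d s -> 0 <= Dl d s.
Proof. by move=> cs; apply: le_trans (flat_union cs). Qed.

Lemma Dl_dim0 s : all_cf d s -> (forall E, E \in s -> fdim d E = 0%N) ->
  Dl d s = 0.
Proof.
move=> cs s0; rewrite /Dl /Delta big1// => I /finset.set0Pn[i Ii].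
rewrite (_ : fdim d _ = 0%N) ?mulr0//; apply/eqP; rewrite -leqn0.
have is' := mem_nth set0 (ltn_ord i); rewrite -(s0 _ is').
by apply: fdim_mono => //; [case: (cs _ is')|move=> x; apply].
Qed.

Definition below L G := [seq F <- L | `[< F `<=` G >] && (F != G)].

Lemma belowP L G F : reflect [/\ F \in L, F `<=` G & F <> G] (F \in below L G).
Proof.
rewrite mem_filter; apply: (iffP andP) => [[/andP[/asboolP FG /eqP ne] FL]|].
  by split.
by move=> [FL FG /eqP ne]; split=> //; rewrite ne andbT; exact/asboolP.
Qed.

Lemma all_cf_below L G : all_cf d L -> all_cf d (below L G).
Proof. by move=> cL F /belowP[/cL]. Qed.

(** The number of dependencies that live on [G] and on no smaller member. *)
Definition alpha L G : int := Dl d (below L G) - (fdim d G)%:Z.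

(** Only members of dimension at least 2 are counted: a member of smaller
    dimension need not be spanned by the members below it, and [alpha] is then
    minus its dimension. *)
Definition rank L (s : nat) : nat :=
  (\sum_(G <- undup L | (1 < fdim d G) && (fdim d G == s)) `|alpha L G|)%N.

(** A finite stage of the analysis of a set [X]: closed sets that are spanned by
    points of [X], stable under intersections, among which are the points
    themselves, the least closed set and the closure of [X].  It is in general
    smaller than the lattice of closed sets of [X], and the latter is a frame only
    if [X] is star-embedded. *)
Record frame X L : Prop := Frame {
  frame_span : forall E, E \in L -> spanned d [set` X] E;
  frame_meet : meet_stable L;
  frame_top : c [set` X] \in L;
  frame_pt : forall x, x \in X -> c [set x] \in L;
  frame_bot : c set0 \in L }.

Lemma frame_cf X L : frame X L -> all_cf d L.
Proof. by move=> fr E /(frame_span fr)/spanned_cf; apply. Qed.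

Lemma cf_cl1 x : cf d (c [set x]).
Proof.
apply: cf_cl => //.
by apply: (finite_dim_sub pgd _ (finite_dim_fset pgd [fset x]%fset)) => y /= ->;
  rewrite inE.
Qed.

Lemma fdim_cl1 x : (fdim d (c [set x]) <= 1)%N.
Proof.
rewrite (_ : [set x] = [set` [fset x]%fset]); last first.
  by apply/seteqP; split=> [y ->|y] /=; rewrite inE // => /eqP.
rewrite (fdim_cl pgd (finite_dim_fset pgd _)) fdim_fset//.
by rewrite (leq_trans (dim_card pgd _))// cardfs1.
Qed.

Lemma cf_bot : cf d (c set0).
Proof.
apply: cf_cl => //.
by apply: (finite_dim_sub pgd _ (finite_dim_fset pgd fset0)).
Qed.

Lemma bot_sub E : cf d E -> c set0 `<=` E.
Proof. by move=> [cE _]; apply: (cl_sub cE). Qed.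

Lemma cf_dim0 E : cf d E -> fdim d E = 0%N -> E = c set0.
Proof.
by move=> cE E0; apply/esym/(cf_eq pgd cf_bot cE (bot_sub cE)); rewrite E0.
Qed.

(** A closed set contains a given point or meets its closure trivially, as this
    closure has dimension at most 1. *)
Lemma cl1_meet x E : cf d E ->
  c [set x] `&` E = c [set x] \/ c [set x] `&` E = c set0.
Proof.
move=> cE; have cx := cf_cl1 x; have cI := cfI pgd cx cE.
have [e|ne] := pselect (c [set x] `&` E = c [set x]); first by left.
right; apply: cf_dim0 => //.
have := cf_lt pgd cI cx (@subIsetl _ _ _) ne; have := fdim_cl1 x; lia.
Qed.

Lemma frame_dim X L E : frame X L -> E \in L -> (fdim d E <= d X)%N.
Proof.
move=> fr /(frame_span fr) sE; have fX := finite_dim_fset pgd X.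
rewrite -(fdim_fset pgd X) -(fdim_cl pgd fX).
apply: fdim_mono => //; first exact: finite_dim_cl.
by rewrite -[X in X `<=` _]sE; apply: cl_mono => x [].
Qed.

Lemma below_pt X L G x : frame X L -> (1 < fdim d G)%N -> c G = G ->
  x \in X -> G x -> exists2 F, F \in below L G & F x.
Proof.
move=> fr G1 cG xX Gx; exists (c [set x]); last exact: sub_cl.
apply/belowP; split; first exact: frame_pt fr _ xX.
  by apply: (cl_sub cG) => y ->.
by move=> eG; move: G1; rewrite -eG ltnNge fdim_cl1.
Qed.

(** Flatness, applied to the members below [G], which contain all points of [X]
    in [G]. *)
Lemma alpha_ge0 X L G : frame X L -> G \in L -> (1 < fdim d G)%N ->
  0 <= alpha L G.
Proof.
move=> fr GL G1; rewrite subr_ge0; have sG := frame_span fr GL.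
apply: (fdim_le_Dl (all_cf_below (frame_cf fr)) sG) => x xX Gx.
exact: below_pt fr G1 (spanned_closed pgd sG) xX Gx.
Qed.

(** No dependency of a member [G] can be explained, using at most [k] closed
    proper subsets of [G], by dependencies of lower dimension. *)
Definition tight k L := forall G s, G \in L -> (size s <= k)%N ->
  (forall S, S \in s -> [/\ cf d S, S `<=` G & S <> G]) ->
  Dl d (below L G) <= Dl d (below L G ++ s).

(** One bounded set of points that spans all members of [t]. *)
Lemma common_spanning t n : all_cf d t ->
  (forall E, E \in t -> (fdim d E <= n)%N) ->
  exists A, [/\ (#|` A| <= size t * n)%N,
    forall x, x \in A -> exists2 E, E \in t & E x
    & forall E, E \in t -> spanned d [set` A] E].
Proof.
elim: t => [|E t IH] ct tn; first by exists fset0; split.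
have [|F Ft|A [An At sA]] := IH.
- by move=> F Ft; apply: ct; rewrite inE Ft orbT.
- by apply: tn; rewrite inE Ft orbT.
have [cE fE] : cf d E by apply: ct; rewrite mem_head.
have [B [BE EB dB cardB]] := finite_dim_basis pgd fE.
have Bn : (#|` B| <= n)%N by rewrite cardB -dB tn// mem_head.
exists (A `|` B)%fset; split=> [|x|F].
- have := cardfsU A B; rewrite /= mulSn; lia.
- rewrite inE => /orP[/At[F Ft Fx]|/BE Ex].
    by exists F; rewrite // inE Ft orbT.
  by exists E; rewrite ?mem_head.
rewrite inE => /orP[/eqP->|/sA sF]; last first.
  by apply: (spanned_sub pgd) sF => x /= xA; rewrite inE xA.
apply/seteqP; split; first by apply: (cl_sub cE) => x [].
apply: subset_trans EB _; apply: cl_mono => x /= xB.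
by split; [rewrite /= inE xB orbT|exact: BE].
Qed.

(** Below a member of dimension at most 1, all alternating sums vanish. *)
Lemma resolved_dim L G s : all_cf d L -> cf d G ->
  (forall S, S \in s -> [/\ cf d S, S `<=` G & S <> G]) ->
  Dl d (below L G ++ s) < Dl d (below L G) -> (1 < fdim d G)%N.
Proof.
move=> cL cG cs; rewrite ltnNge; apply: contraTN => G1; rewrite -leNgt.
rewrite [leLHS]Dl_dim0; first by apply/Dl_ge0/all_cf_cat => [|S /cs[]//];
  exact: all_cf_below.
  exact: all_cf_below.
move=> F /belowP[/cL cF FG neq]; have := cf_lt pgd cF cG FG neq; lia.
Qed.

(** Adding the sets that resolve [G], and points that span them, creates members
    of dimension smaller than that of [G] only; it lowers [alpha] at [G] and does
    not change it at the members that are not contained in [G]. *)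
Lemma resolve X L G s D : frame X L -> G \in L ->
  (forall S, S \in s -> [/\ cf d S, S `<=` G & S <> G]) ->
  Dl d (below L G ++ s) < Dl d (below L G) -> (d X <= D)%N ->
  exists X' L', [/\ frame X' L', (X `<=` X')%fset /\ c [set` X'] = c [set` X],
    (#|` X'| <= #|` X| + 2 ^ (size L + size s) * #|` X|)%N,
    (size L' <= 2 ^ (size L + size s) + #|` X'|)%N &
    lt_lex D (rank L') (rank L)].
Proof.
move=> fr GL ss ltG XD; have cL := frame_cf fr; have cG := cL _ GL.
have cs : all_cf d s by move=> S /ss[].
have G1 := resolved_dim cL cG ss ltG.
pose L1 := meets (L ++ s).
have L1N E : E \in L1 -> E \in L \/ exists2 S, S \in s & E `<=` S.
  apply: (@meets_ind _ _ (fun E => E \in L \/ exists2 S, S \in s & E `<=` S)).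
    by move=> F; rewrite mem_cat => /orP[|Fs]; [left|right; exists F].
  move=> F F' [FL|[S Ss FS]]; last first.
    by move=> _; right; exists S => // x [/FS].
  move=> [F'L|[S Ss FS]]; last by right; exists S => // x [_ /FS].
  by left; exact: frame_meet fr _ _ FL F'L.
have cL1 : all_cf d L1 by apply: all_cf_meets => //; exact: all_cf_cat.
have GX : G `<=` c [set` X].
  by rewrite -[X in X `<=` _](frame_span fr GL); apply: cl_mono => x [].
(* The old members are spanned by [X] already.  Choosing new points inside the
   new members only keeps all their closures below [s]. *)
pose t := [seq E <- L1 | E \notin L].
have tN E : E \in t -> exists2 S, S \in s & E `<=` S.
  by rewrite mem_filter => /andP[/negP nL /L1N[]].
have [|E|A [cardA At sA]] := @common_spanning t #|` X|.
- by move=> E; rewrite mem_filter => /andP[_ /cL1].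
- move=> /tN[S /ss[_ SG _] ES]; apply: leq_trans (dim_card pgd X).
  apply: leq_trans (frame_dim fr GL); apply: fdim_mono => //; first by case: cG.
  exact: subset_trans SG.
pose X' := (X `|` A)%fset; pose L' := L1 ++ [seq c [set x] | x <- X'].
have XX' : [set` X] `<=` [set` X'] by move=> x /= xX; rewrite inE xX.
have AX' : [set` A] `<=` [set` X'] by move=> x /= xA; rewrite inE xA orbT.
have LL1 : {subset L <= L1} by move=> E EL; apply: sub_meets; rewrite mem_cat EL.
have LL' : {subset L <= L'} by move=> E /LL1 EL; rewrite mem_cat EL.
have sL1 : {subset s <= L1}.
  by move=> S Ss; apply: sub_meets; rewrite mem_cat Ss orbT.
have L'N E : E \in L' -> E \in L \/ exists2 S, S \in s & E `<=` S.
  rewrite mem_cat => /orP[/L1N//|/mapP[x]]; rewrite /= inE => /orP[xX|xA] ->.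
    by left; exact: frame_pt fr _ xX.
  have [F /tN[S Ss FS] Fx] := At _ xA; right; exists S => //.
  by have [[cS _] _ _] := ss _ Ss; apply: (cl_sub cS) => y ->; exact: FS.
have clX' : c [set` X'] = c [set` X].
  apply/seteqP; split; last exact: cl_mono.
  apply: (cl_min pgd) => x /=; rewrite inE => /orP[xX|/At[F /tN[S /ss[_ SG _] FS]]].
    exact: sub_cl.
  by move=> /FS/SG/GX.
have ptL' x : x \in X' -> c [set x] \in L'.
  by move=> xX'; rewrite mem_cat; apply/orP; right; apply/mapP; exists x.
have fr' : frame X' L'.
  split=> //.
  - move=> E; rewrite mem_cat => /orP[EL1|/mapP[x xX' ->]]; last first.
      by apply: spanned_cl => // y ->.
    have [EL|nEL] := boolP (E \in L).
      exact: (spanned_sub pgd XX' (frame_span fr EL)).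
    by apply: (spanned_sub pgd AX'); apply: sA; rewrite mem_filter nEL.
  - have ptI x E : x \in X' -> cf d E -> c [set x] `&` E \in L'.
      move=> xX' cE; have [->|->] := cl1_meet x cE; last exact/LL'/(frame_bot fr).
      exact: ptL'.
    move=> E F; rewrite !mem_cat => /orP[E1|/mapP[x xX' ->]] /orP[F1|/mapP[y yX' ->]].
    + by rewrite meets_closed.
    + by rewrite setIC -mem_cat; apply: ptI => //; exact: cL1.
    + by rewrite -mem_cat; apply: ptI => //; exact: cL1.
    + by rewrite -mem_cat; apply: ptI => //; exact: cf_cl1.
  - by rewrite clX'; exact/LL'/(frame_top fr).
  - exact/LL'/(frame_bot fr).
have cL' := frame_cf fr'.
(* Outside [G], a new set below [E] is contained in the old member [E `&` G]. *)
have alphaE E : E \in L -> ~ E `<=` G -> alpha L' E = alpha L E.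
  move=> EL nEG; congr (_ - _); apply: Dl_eq => //; try exact: all_cf_below.
    move=> F /belowP[FL' FE neq]; have [FL|[S Ss FS]] := L'N _ FL'.
      by exists F => //; apply/belowP.
    have [_ SG _] := ss _ Ss; exists (E `&` G).
      apply/belowP; split; [exact: frame_meet fr _ _ EL GL|by move=> x []|].
      by move=> EG; apply: nEG; rewrite -EG => x [].
    by move=> x Fx; split; [exact: FE|exact/SG/FS].
  by apply: dominated_subset => F /belowP[/LL' FL' FE neq]; apply/belowP.
have alphaG : alpha L' G < alpha L G.
  rewrite ltrD2r (_ : Dl d (below L' G) = Dl d (below L G ++ s))//.
  apply: Dl_eq => //.
  - exact: all_cf_below.
  - by apply: all_cf_cat => //; exact: all_cf_below.
  - move=> F /belowP[/L'N[FL|[S Ss FS]] FG neq].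
      by exists F => //; rewrite mem_cat; apply/orP; left; apply/belowP.
    by exists S => //; rewrite mem_cat Ss orbT.
  - apply: dominated_cat; apply: dominated_subset.
      by move=> F /belowP[/LL' FL' FG neq]; apply/belowP.
    move=> S Ss; have [_ SG neq] := ss _ Ss; apply/belowP; split=> //.
    by rewrite mem_cat sL1.
have topL E : E \in L' -> (fdim d G <= fdim d E)%N -> E \in L.
  move=> /L'N[//|[S /ss[cS SG neq] ES] GE].
  have := cf_lt pgd cS cG SG neq; have := fdim_mono pgd cS.2 ES; lia.
have rankE r : (fdim d G <= r)%N -> rank L' r =
    (\sum_(E <- undup L | (1 < fdim d E)%N && (fdim d E == r)) `|alpha L' E|)%N.
  move=> Gr; rewrite /rank -big_filter -[RHS]big_filter; apply: perm_big.
  apply: uniq_perm; try exact/filter_uniq/undup_uniq.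
  move=> E; rewrite !mem_filter !mem_undup.
  case: (boolP ((1 < fdim d E)%N && (fdim d E == r))) => //= /andP[_ /eqP Er].
  by apply/idP/idP => [/topL|/LL'//]; apply; rewrite Er.
exists X', L'; split=> //.
- by split=> //; exact: fsubsetUl.
- have size_t : (size t <= 2 ^ (size L + size s))%N.
    rewrite (leq_trans (size_subseq (filter_subseq _ _)))// -size_cat -size_meets.
    exact: leqnSn.
  rewrite /X' cardfsU (leq_trans (leq_subr _ _))// leq_add2l.
  by rewrite (leq_trans cardA)// leq_mul.
- by rewrite size_cat size_map leq_add2r -size_cat -size_meets leqnSn.
exists (fdim d G); split.
- exact: leq_trans (frame_dim fr GL) XD.
- rewrite rankE//; apply: (@sum_lt _ _ _ _ _ G).
  + by rewrite mem_undup.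
  + by rewrite G1 eqxx.
  + have := alpha_ge0 fr' (LL' _ GL) G1; have := alpha_ge0 fr GL G1; lia.
  + move=> E; rewrite mem_undup => EL /andP[_ /eqP EG].
    have [->|/eqP neq] := eqVneq E G.
      have := alpha_ge0 fr' (LL' _ GL) G1; have := alpha_ge0 fr GL G1; lia.
    rewrite alphaE// => sEG.
    by have := cf_lt pgd (cL _ EL) cG sEG neq; rewrite EG ltnn.
move=> r /andP[Gr _]; rewrite rankE 1?ltnW// /rank.
rewrite big_seq_cond [RHS]big_seq_cond; apply: eq_bigr => E.
rewrite mem_undup => /andP[EL /andP[_ /eqP Er]]; rewrite alphaE// => sEG.
by have := fdim_mono pgd cG.2 sEG; lia.
Qed.

End Frames.

(** * Tight frames give star-embedded sets *)

Lemma seq_max (T : eqType) (r : T -> nat) (s : seq T) : s != [::] ->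
  exists2 x, x \in s & forall y, y \in s -> r y <= r x.
Proof.
elim: s => // x s IH _; have [->|/IH[y ys ymax]] := eqVneq s [::].
  by exists x => [|y]; rewrite ?mem_head// inE => /eqP->.
have [xy|yx] := leqP (r x) (r y).
  by exists y => [|z]; rewrite inE ?ys ?orbT// => /orP[/eqP->//|/ymax].
exists x => [|z]; first exact: mem_head.
rewrite inE => /orP[/eqP->//|/ymax zy]; exact: leq_trans zy (ltnW yx).
Qed.

Lemma size_filter_neq (T : eqType) (s : seq T) x :
  x \in s -> size [seq y <- s | y != x] < size s.
Proof.
move=> xs; rewrite size_filter -(count_predC (pred1 x) s) -addn1 addnC.
by rewrite leq_add2r -has_count has_pred1.
Qed.

Section Star.
Variables (M : choiceType) (d : {fset M} -> nat).
Hypothesis pgd : pregeometry d.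
Implicit Types (A B X : {fset M}) (E F G Y Z : set M).
Local Notation c := (cl d setT).

Lemma clE G Y : cl d G Y = G `&` c Y.
Proof.
by apply/seteqP; split=> x [Gx]; [case=> A AY dA; split=> //; split=> //; exists A|
  case=> _ [A AY dA]; split=> //; exists A].
Qed.

Lemma closed_inE G Y : closed_in d G Y <-> Y `<=` G /\ G `&` c Y = Y.
Proof. by rewrite /closed_in clE. Qed.

(** Being star-embedded, in terms of closed sets of the whole pregeometry. *)
Definition stable_span X := forall E F,
  spanned d [set` X] E -> spanned d [set` X] F -> spanned d [set` X] (E `&` F).

Lemma finite_dimIX X E : finite_dim d ([set` X] `&` E).
Proof. by apply: (finite_dim_sub pgd _ (finite_dim_fset pgd X)) => x []. Qed.

Lemma star_embeddedP X : star_embedded d [set` X] setT <-> stable_span X.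
Proof.
split=> [[_ st] E F sE sF|st].
  have closedX Y : spanned d [set` X] Y -> closed_in d [set` X] ([set` X] `&` Y).
    by move=> sY; apply/closed_inE; rewrite sY; split=> // x [].
  have := st _ _ (closedX _ sE) (closedX _ sF); rewrite sE sF.
  rewrite setIACA setIid => dimI; have cI := cfI pgd (spanned_cf pgd sE) (spanned_cf pgd sF).
  move: dimI; rewrite !dimE//; [|by case: cI|exact: finite_dimIX] => -[dimI].
  apply/seteqP; split; first by apply: (cl_sub cI.1) => x [].
  by apply: (fdim_span pgd); [case: cI|move=> x []|rewrite dimI].
split=> // X1 X2 /closed_inE[X1X cX1] /closed_inE[X2X cX2].
have sI := st _ _ (spanned_cl pgd X1X) (spanned_cl pgd X2X).
have XI : [set` X] `&` (c X1 `&` c X2) = X1 `&` X2.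
  by rewrite -[in RHS]cX1 -[in RHS]cX2 setIACA setIid.
rewrite -sI XI; have fI : finite_dim d (X1 `&` X2).
  by rewrite -XI; exact: finite_dimIX.
by rewrite !dimE ?fdim_cl//; exact: finite_dim_cl.
Qed.

Definition fcut X E : {fset M} := [fset x in X | `[< E x >]]%fset.

Lemma fcutP X E x : reflect (x \in X /\ E x) (x \in fcut X E).
Proof.
rewrite !inE; apply: (iffP andP) => -[xX]; first by move=> /asboolP.
by move=> Ex; split=> //; exact/asboolP.
Qed.

Lemma fcutE X E : [set` fcut X E] = [set` X] `&` E.
Proof.
by apply/seteqP; split=> x /fcutP.
Qed.

(** The lattice of closed sets of [X], as closed sets of the whole pregeometry. *)
Definition closures X : seq (set M) :=
  [seq c [set` (A : {fset M})] | A <- fpowerset X].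

Lemma size_closures X : size (closures X) = 2 ^ #|` X|.
Proof. by rewrite size_map card_fpowerset. Qed.

Lemma closuresP X E : reflect (spanned d [set` X] E) (E \in closures X).
Proof.
apply: (iffP mapP) => [[A]|sE].
  by rewrite fpowersetE => /fsubsetP AX ->; exact: spanned_cl.
exists (fcut X E); last by rewrite fcutE sE.
by rewrite fpowersetE; apply/fsubsetP => x /fcutP[].
Qed.

Lemma frame_closures X : stable_span X -> frame d X (closures X).
Proof.
move=> st; split.
- by move=> E /closuresP.
- by move=> E F /closuresP sE /closuresP sF; exact/closuresP/st.
- by apply/closuresP; exact: spanned_cl.
- by move=> x xX; apply/closuresP; apply: spanned_cl => // y ->.
- by apply/closuresP; exact: spanned_cl.
Qed.

End Star.

Section TightFrames.
Variables (M : choiceType) (d : {fset M} -> nat).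
Hypotheses (pgd : pregeometry d) (fld : flat d).
Implicit Types (A B : {fset M}) (E F G Y Z : set M).
Implicit Types (s t u : seq (set M)).
Local Notation c := (cl d setT).
Local Open Scope ring_scope.

(** By flatness, no dependency is lost when a set is added that is spanned by
    points which are already there. *)
Lemma Dl_add_spanned (X : {fset M}) s t : all_cf d s ->
  (forall E, E \in t -> spanned d [set` X] E) ->
  (forall E x, E \in t -> x \in X -> E x -> exists2 F, F \in s & F x) ->
  Dl d (s ++ t) <= Dl d s.
Proof.
elim: t s => [|E t IH] s cs st ts; first by rewrite cats0.
have sE := st E (mem_head _ _); have cE := spanned_cf pgd sE.
have cE1 : all_cf d [:: E] by move=> F; rewrite inE => /eqP->.
rewrite -cat1s catA; apply: le_trans (IH _ _ _ _) _.
- exact: all_cf_cat.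
- by move=> F Ft; apply: st; rewrite inE Ft orbT.
- move=> F x Ft xX Fx; have [|H Hs Hx] := ts F x _ xX Fx.
    by rewrite inE Ft orbT.
  by exists H => //; rewrite mem_cat Hs.
rewrite Dl_cat1// lerBlDr lerD2l; apply: (fdim_le_Dl pgd fld _ sE).
  exact: all_cf_meetl.
move=> x xX Ex; have [H Hs Hx] := ts E x (mem_head _ _) xX Ex.
by exists (H `&` E); [apply: mem_meetl; rewrite ?mem_head|].
Qed.

Variables (X : {fset M}) (L : seq (set M)).
Hypotheses (fr : frame d X L) (ti : tight d 2 L).

Local Notation sp := (spanned d [set` X]).

Let cL : all_cf d L := frame_cf pgd fr.
Let sL E : E \in L -> sp E := @frame_span _ _ _ _ fr E.
Let sp_cf E : sp E -> cf d E := @spanned_cf _ _ pgd X E.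

Let cf_belowL G : all_cf d (below L G).
Proof. exact: all_cf_below. Qed.

(** By induction on the dimension, intersections of spanned sets may be assumed
    to be spanned inside the members below [G]. *)
Section Inside.
Variable G : set M.
Hypotheses (GL : G \in L) (G1 : (1 < fdim d G)%N).
Hypothesis IHG : forall F, F \in below L G ->
  forall E1 E2, E1 `<=` F -> E2 `<=` F -> sp E1 -> sp E2 -> sp (E1 `&` E2).
Let cG : cf d G := cL GL.

Section Meet.
Variable E : set M.
Hypotheses (sE : sp E) (EG : E `<=` G) (neEG : E <> G).

Let core F := c ([set` X] `&` (F `&` E)).

Let sp_core F : sp (core F).
Proof. by apply: spanned_cl => // x []. Qed.

Let core_sub F : F \in L -> core F `<=` F `&` E.
Proof.
move=> /cL cF; have [cFE _] := cfI pgd cF (sp_cf sE).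
by apply: (cl_sub cFE) => x [].
Qed.

Let cf_core F : cf d (core F) := sp_cf (sp_core F).

Let cf_cores p : all_cf d [seq core F | F <- p].
Proof. by move=> _ /mapP[F _ ->]. Qed.

Let cf_meetE p : all_cf d p -> all_cf d (meetl p [:: E]).
Proof.
by move=> cp; apply: all_cf_meetl => // F; rewrite inE => /eqP->; exact: sp_cf.
Qed.

Let meetE p F : F \in p -> F `&` E \in meetl p [:: E].
Proof. by move=> Fp; apply: mem_meetl; rewrite ?mem_head. Qed.

Let meetEP p H : H \in meetl p [:: E] -> exists2 F, F \in p & H = F `&` E.
Proof.
by move=> /meetlP[F [F1 [Fp /[!inE]-> ->]]]; exists F.
Qed.

(** Inside [F], the set [F `&` E] contributes at least what is new in it. *)
Let new_part F : F \in below L G ->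
  Dl d (meetl (below L F) [:: E] ++ [:: core F]) <= (fdim d (F `&` E))%:Z.
Proof.
move=> /belowP[FL FG neFG]; have cF := cL FL; have cFE := cfI pgd cF (sp_cf sE).
set W := _ ++ _; have cW : all_cf d W.
  apply: all_cf_cat; first exact: cf_meetE.
  by move=> H; rewrite inE => /eqP->.
have W_sub H : H \in W -> H `<=` F `&` E.
  rewrite mem_cat => /orP[/meetEP[F2 /belowP[_ F2F _] ->]|].
    by move=> x [/F2F]; split.
  by rewrite inE => /eqP->; exact: core_sub.
have W_dim H : H \in W -> (fdim d H <= fdim d (F `&` E))%N.
  by move=> /W_sub; apply: fdim_mono => //; case: cFE.
(* Tightness at [F] is used for the pair [core F], [F `&` E], which must consist
   of proper subsets of [F]; the degenerate cases come first. *)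
have [FE0|FE0] := eqVneq (fdim d (F `&` E)) 0%N.
  rewrite Dl_dim0 ?FE0// => H HW; apply/eqP; rewrite -leqn0 -FE0.
  exact: W_dim.
have [eFE|neFE] := pselect (F `&` E = F).
  have cFF : core F = F by rewrite /core eFE; exact: sL.
  rewrite eFE -Dl1//.
  suff -> : Dl d W = Dl d [:: F] by [].
  apply: Dl_eq => //.
  - by move=> H; rewrite inE => /eqP->.
  - move=> H HW; exists F; first exact: mem_head.
    by move=> x /(W_sub _ HW)[].
  - move=> H; rewrite inE => /eqP->; exists F => //.
    by rewrite mem_cat cFF mem_head orbT.
have F1 : (1 < fdim d F)%N.
  have := cf_lt pgd cFE cF (@subIsetl _ _ _) neFE; lia.
have neFc : core F <> F.
  by move=> cFF; apply: neFE; apply/seteqP; split=> [x []//|]; rewrite -{1}cFF;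
     exact: core_sub.
pose B := below L F.
have cB : all_cf d B by exact: cf_belowL.
have cc1 : all_cf d [:: core F] by move=> H; rewrite inE => /eqP->.
have := @ti F [:: core F; F `&` E] FL isT.
have -> : B ++ [:: core F; F `&` E] = (B ++ [:: core F]) ++ [:: F `&` E].
  by rewrite -catA.
rewrite -/B => /(_ _)/le_trans tiF.
have {tiF} : Dl d B <= Dl d (B ++ [:: core F]) + (fdim d (F `&` E))%:Z
    - Dl d (meetl (B ++ [:: core F]) [:: F `&` E]).
  rewrite -(Dl_cat1 pgd (all_cf_cat cB cc1) cFE).
  apply: tiF => // S; rewrite !inE => /orP[]/eqP->; split=> //.
  by move=> x /(core_sub FL)[].
have -> : Dl d (meetl (B ++ [:: core F]) [:: F `&` E]) = Dl d W.
  apply: Dl_eq => //.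
  - apply: (all_cf_meetl pgd (all_cf_cat cB cc1)).
    by move=> H; rewrite inE => /eqP->.
  - move=> _ /meetlP[H [H1 [+ /[!inE]-> ->]]].
    rewrite mem_cat => /orP[HB|]; last first.
      rewrite inE => /eqP->; exists (core F); last by move=> x [].
      by rewrite mem_cat mem_head orbT.
    exists (H `&` E); last by move=> x [? []].
    by rewrite mem_cat meetE.
  - move=> H HW; have HFE := W_sub _ HW.
    move: HW; rewrite mem_cat => /orP[/meetEP[F2 F2B eH]|].
      exists (F2 `&` (F `&` E)); last first.
        by move=> x Hx; split; [move: Hx; rewrite eH => -[]|exact: HFE].
      by apply: mem_meetl; rewrite ?mem_head// mem_cat F2B.
    rewrite inE => /eqP eH; exists (core F `&` (F `&` E)).
      by apply: mem_meetl; rewrite ?mem_head// mem_cat mem_head orbT.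
    by move=> x Hx; split; [rewrite -eH|exact: HFE].
have : Dl d (B ++ [:: core F]) <= Dl d B.
  apply: (@Dl_add_spanned X) => // H.
    by rewrite inE => /eqP->.
  move=> x; rewrite inE => /eqP-> xX /(core_sub FL)[Fx _].
  by apply: (below_pt pgd fr F1) => //; case: cF.
by lia.
Qed.

Let cover p := [seq core F | F <- below L G] ++ meetl p [:: E].

(** Build the family [F `&` E], for [F] below [G], one member at a time, the
    smaller ones first, starting from the spanned parts.  The alternating sum is
    at least the dimension of [E] at the start by flatness, never decreases by
    [new_part], and increases when a member is not spanned by points of [X]. *)
Let covering p : {subset p <= below L G} ->
  (forall F F', F \in p -> F' \in below L G -> F' `<=` F -> F' \in p) ->
  (fdim d E)%:Z <= Dl d (cover p) /\
  ((exists2 F, F \in p & ~ sp (F `&` E)) -> (fdim d E)%:Z < Dl d (cover p)).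
Proof.
have [n] := ubnP (size p); elim: n p => // n IH p pn pA pdown; set Q := cover p.
have cp : all_cf d p by move=> F /pA; exact: cf_belowL.
have cQ : all_cf d Q by apply: all_cf_cat => //; exact: cf_meetE.
have [p0|/(seq_max (fdim d))[F Fp Fmax]] := eqVneq p [::].
  split; last by rewrite p0 => -[].
  apply: (fdim_le_Dl pgd fld cQ sE) => x xX Ex.
  have [F FA Fx] := below_pt pgd fr G1 cG.1 xX (EG Ex).
  exists (core F); first by rewrite mem_cat map_f.
  by apply: sub_cl.
have /belowP[FL FG neFG] := pA _ Fp; have cF := cL FL.
pose p' := [seq H <- p | H != F].
have p'p : {subset p' <= p} by move=> H; rewrite mem_filter => /andP[].
have inp' H : H \in p -> H <> F -> H \in p'.
  by move=> Hp /eqP neq; rewrite mem_filter neq.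
have not_above H : H \in p -> H <> F -> ~ F `<=` H.
  move=> Hp neq FH; have := cf_lt pgd cF (cp _ Hp) FH (nesym neq).
  by rewrite ltnNge Fmax.
have below_p' H : H \in below L F -> H \in p'.
  move=> /belowP[HL HF neq]; apply: inp' => //; apply: (pdown _ _ Fp) => //.
  apply/belowP; split=> //; first exact: subset_trans FG.
  by move=> eHG; apply: neFG; apply/seteqP; split=> //; rewrite -eHG.
have [|||geQ' gtQ'] := IH p'.
- exact: leq_trans (size_filter_neq Fp) pn.
- by move=> H /p'p/pA.
- move=> H H' /[dup] + /p'p Hp H'A H'H; rewrite mem_filter => /andP[/eqP neq _].
  apply: inp'; first exact: pdown H'H.
  by move=> eH'; apply: (not_above _ Hp neq); rewrite -eH'.
set Q' := cover p' in geQ' gtQ'.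
have cQ' : all_cf d Q'.
  by apply: all_cf_cat => //; apply: cf_meetE => H /p'p/cp.
have cFE := cfI pgd cF (sp_cf sE).
have QE : Dl d Q = Dl d (Q' ++ [:: F `&` E]).
  apply: Dl_eq => //.
  - by apply: all_cf_cat => // H; rewrite inE => /eqP->.
  - apply: dominated_cat.
      by apply: dominated_subset => H HA; rewrite !mem_cat HA.
    apply: dominated_subset => _ /meetEP[H Hp ->].
    have [->|/eqP neq] := eqVneq H F; first by rewrite mem_cat mem_head orbT.
    by rewrite !mem_cat (meetE (inp' _ Hp neq)) orbT.
  - apply: dominated_cat; apply: dominated_subset => H.
      rewrite !mem_cat => /orP[->//|/meetEP[H' /p'p H'p ->]].
      by rewrite meetE// orbT.
    by rewrite inE => /eqP->; rewrite mem_cat meetE// orbT.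
have coverF : Dl d (meetl Q' [:: F `&` E]) =
    Dl d (meetl (below L F) [:: E] ++ [:: core F]).
  apply: Dl_eq => //.
  - by apply: all_cf_meetl => // H; rewrite inE => /eqP->.
  - apply: all_cf_cat; first exact: cf_meetE.
    by move=> H; rewrite inE => /eqP->.
  - move=> _ /meetlP[H [H1 [+ /[!inE]-> ->]]].
    rewrite mem_cat => /orP[/mapP[H' H'A ->]|/meetEP[H' H'p' ->]].
      have /belowP[H'L _ _] := H'A.
      exists (core F); first by rewrite mem_cat mem_head orbT.
      have sI : sp (core H' `&` (H' `&` F)).
        apply: (IHG H'A) => //; first by move=> x /(core_sub H'L)[].
        exact: sL (frame_meet fr H'L FL).
      have sub1 : core H' `&` (H' `&` F) `<=` core F.
        apply: (spanned_min sI); first by case: (cf_core F).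
        move=> x [Xx [cx [_ Fx]]]; apply: sub_cl; split=> //; split=> //.
        by case: (core_sub H'L cx).
      apply: subset_trans sub1 => x [cx [Fx _]]; split=> //; split=> //.
      by case: (core_sub H'L cx).
    have H'p := p'p _ H'p'; have /belowP[H'L _ _] := pA _ H'p.
    exists ((H' `&` F) `&` E); last by move=> x [[? ?] [? ?]].
    rewrite mem_cat meetE//; apply/belowP; split.
    + exact: frame_meet fr _ _ H'L FL.
    + by move=> x [].
    + move: H'p'; rewrite mem_filter => /andP[/eqP neq _] eF.
      by apply: (not_above _ H'p neq); rewrite -eF => x [].
  - apply: dominated_cat.
      move=> _ /meetEP[H HB ->]; have /belowP[HL HF _] := HB.
      exists ((H `&` E) `&` (F `&` E)).
        apply: mem_meetl; rewrite ?mem_head// mem_cat meetE ?orbT//.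
        exact: below_p'.
      by move=> x [Hx Ex]; split; split=> //; exact: HF.
    move=> H; rewrite inE => /eqP->; exists (core F `&` (F `&` E)).
      by apply: mem_meetl; rewrite ?mem_head// mem_cat map_f// pA.
    by move=> x cx; split=> //; exact: core_sub cx.
have newF := new_part (pA _ Fp).
rewrite QE Dl_cat1// coverF; split; first by lia.
have [/gtQ'|nbad] := pselect (exists2 H, H \in p' & ~ sp (H `&` E)); first by lia.
move=> [H Hp badH]; have eHF : H = F.
  by apply: contrapT => /(inp' _ Hp) Hp'; apply: nbad; exists H.
rewrite eHF in badH.
suff -> : Dl d (meetl (below L F) [:: E] ++ [:: core F]) = Dl d [:: core F].
  rewrite Dl1//; suff : (fdim d (core F) < fdim d (F `&` E))%N by lia.
  apply: (cf_lt pgd (cf_core F) cFE (core_sub FL)).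
  by move=> ecF; apply: badH; rewrite -ecF.
apply: Dl_eq => //.
- apply: all_cf_cat; first exact: cf_meetE.
  by move=> K; rewrite inE => /eqP->.
- by move=> K; rewrite inE => /eqP->.
- apply: dominated_cat; last exact: dominated_subset.
  move=> _ /meetEP[K KB ->]; exists (core F); first exact: mem_head.
  have /belowP[_ KF _] := KB.
  have sK : sp (K `&` E).
    by apply: contrapT => bad; apply: nbad; exists K => //; exact: below_p'.
  apply: (spanned_min sK); first by case: (cf_core F).
  by move=> x [Xx [Kx Ex]]; apply: sub_cl; split=> //; split=> //; exact: KF.
- by apply: dominated_subset => K KF; rewrite mem_cat KF orbT.
Qed.

(** As [E] resolves nothing on [G], its dependencies are those of its
    intersections with the members below [G]. *)
Lemma tight1 : Dl d (meetl (below L G) [:: E]) <= (fdim d E)%:Z.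
Proof.
have := @ti G [:: E] GL isT; rewrite Dl_cat1//; last exact: sp_cf.
move=> /(_ _)/wrap[]; last by lia.
by move=> S; rewrite inE => /eqP->; split=> //; exact: sp_cf.
Qed.

(** Otherwise [covering] would make the alternating sum in [tight1] too large. *)
Lemma spanned_meet_below F : F \in below L G -> sp (F `&` E).
Proof.
move=> FA; apply: contrapT => bad.
have [//|//|_ gtE] := @covering (below L G).
have /gtE : exists2 F, F \in below L G & ~ sp (F `&` E) by exists F.
apply/negP; rewrite -leNgt; apply: le_trans tight1.
rewrite le_eqVlt; apply/orP; left; apply/eqP; apply: Dl_eq => //.
- by apply: all_cf_cat => //; exact: cf_meetE.
- exact: cf_meetE.
- apply: dominated_cat; last exact: dominated_subset.
  move=> _ /mapP[H HA ->]; exists (H `&` E); first exact: meetE.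
  by apply: core_sub; case/belowP: HA.
- by apply: dominated_subset => H HA; rewrite mem_cat HA orbT.
Qed.

End Meet.
End Inside.
End TightFrames.

Section TightStar.
Variables (M : choiceType) (d : {fset M} -> nat).
Hypotheses (pgd : pregeometry d) (fld : flat d).
Variables (X : {fset M}) (L : seq (set M)).
Hypotheses (fr : frame d X L) (ti : tight d 2 L).
Implicit Types (E F G : set M).
Local Open Scope ring_scope.
Local Notation c := (cl d setT).
Local Notation sp := (spanned d [set` X]).

Let cL : all_cf d L := frame_cf pgd fr.

(** If [E1 `&` E2] had a point outside of the span [E0] of its points in [X],
    then adding [E1] and [E2] would resolve [G]: inside the members below [G] the
    intersection is no larger than [E0], so that [E2] meets the family enlarged by
    [E1] in more than flatness allows. *)
Lemma tight_stable_at G : G \in L -> forall E1 E2,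
  E1 `<=` G -> E2 `<=` G -> sp E1 -> sp E2 -> sp (E1 `&` E2).
Proof.
have [n] := ubnP (fdim d G); elim: n G => // n IH G Gn GL.
have cG := cL GL; have sG := frame_span fr GL.
have IHG F : F \in below L G ->
    forall E1 E2, E1 `<=` F -> E2 `<=` F -> sp E1 -> sp E2 -> sp (E1 `&` E2).
  move=> /belowP[FL FG neq]; apply: IH => //.
  have := cf_lt pgd (cL FL) cG FG neq; lia.
move=> E1 E2 E1G E2G s1 s2; have c1 := spanned_cf pgd s1.
have c2 := spanned_cf pgd s2.
have [->|ne1] := pselect (E1 = G); first by rewrite (setIidr E2G).
have [->|ne2] := pselect (E2 = G); first by rewrite (setIidl E1G).
have [G1|G1] := leqP (fdim d G) 1.
  have E10 : E1 = c set0.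
    by apply: cf_dim0 => //; have := cf_lt pgd c1 cG E1G ne1; lia.
  by rewrite E10 (setIidl (bot_sub c2)); exact: spanned_cl.
set A := below L G; have cA : all_cf d A by exact: all_cf_below.
have cA1 : all_cf d (A ++ [:: E1]).
  by apply: all_cf_cat => // F; rewrite inE => /eqP->.
have cI := cfI pgd c1 c2.
pose E0 := c ([set` X] `&` (E1 `&` E2)).
have s0 : sp E0 by apply: spanned_cl => // x [].
have c0 := spanned_cf pgd s0.
have E0I : E0 `<=` E1 `&` E2 by apply: (cl_sub cI.1) => x [].
have cA2 : all_cf d (meetl A [:: E2]).
  by apply: all_cf_meetl => // F; rewrite inE => /eqP->.
have ptA x : x \in X -> G x -> exists2 F, F \in A & F x.
  by move=> xX Gx; exact: (below_pt pgd fr G1 cG.1 xX Gx).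
have add1 : Dl d (A ++ [:: E1]) <= Dl d A.
  apply: (Dl_add_spanned pgd fld (X := X)) => // F; first by rewrite inE => /eqP->.
  by move=> x; rewrite inE => /eqP-> xX /E1G; exact: ptA.
have add2 : Dl d A <= Dl d ((A ++ [:: E1]) ++ [:: E2]).
  rewrite -catA; apply: ti => // S; rewrite !inE => /orP[]/eqP->; by split.
have flatE : (fdim d E2)%:Z <= Dl d (meetl A [:: E2] ++ [:: E0]).
  apply: (fdim_le_Dl pgd fld _ s2).
    by apply: all_cf_cat => // F; rewrite inE => /eqP->.
  move=> x xX E2x; have [F FA Fx] := ptA x xX (E2G _ E2x).
  by exists (F `&` E2) => //; rewrite mem_cat mem_meetl// mem_head.
have sM F : F \in A -> sp (F `&` E1) /\ sp (F `&` E2).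
  by move=> FA; split; exact: (spanned_meet_below pgd fld fr ti GL G1 IHG).
have DI : Dl d (meetl (meetl A [:: E2]) [:: E0]) =
    Dl d (meetl (meetl A [:: E2]) [:: E1 `&` E2]).
  apply: Dl_eq => //; try by apply: all_cf_meetl => // F; rewrite inE => /eqP->.
    move=> _ /meetlP[F [F' [FA /[!inE]-> ->]]]; exists (F `&` (E1 `&` E2)).
      by apply: mem_meetl; rewrite ?mem_head.
    by move=> x [Fx /E0I].
  move=> _ /meetlP[H [F' [/meetlP[F [F'' [FA + ->]]] + ->]]].
  rewrite !mem_seq1 => /eqP-> /eqP->.
  exists ((F `&` E2) `&` E0).
    by apply: mem_meetl; rewrite ?mem_head// mem_meetl// mem_head.
  have [sF1 sF2] := sM _ FA.
  have sI : sp ((F `&` E1) `&` (F `&` E2)).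
    by apply: (IHG F FA) => // x [].
  have sub0 : (F `&` E1) `&` (F `&` E2) `<=` E0.
    apply: (spanned_min sI); first by case: c0.
    by move=> x [Xx [[_ ?] [_ ?]]]; apply: sub_cl.
  by move=> x [[Fx E2x] [E1x _]]; split=> //; apply: sub0.
have Dcat : Dl d (meetl (A ++ [:: E1]) [:: E2]) =
    Dl d (meetl A [:: E2] ++ [:: E1 `&` E2]).
  by rewrite /meetl allpairs_cat/=.
rewrite (Dl_cat1 pgd cA2 c0) in flatE.
rewrite (Dl_cat1 pgd cA1 c2) Dcat (Dl_cat1 pgd cA2 cI) -DI in add2.
have dI : (fdim d (E1 `&` E2) <= fdim d E0)%N by lia.
by rewrite /spanned -/E0; exact: (cf_eq pgd c0 cI E0I dI).
Qed.

Lemma tight_stable : stable_span d X.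
Proof.
move=> E F sE sF; apply: (tight_stable_at (frame_top fr)) => //.
  by rewrite -sE; apply: cl_mono => x [].
by rewrite -sF; apply: cl_mono => x [].
Qed.

Let frX := frame_closures pgd tight_stable.

Let LX : {subset L <= closures d X}.
Proof. by move=> E /(frame_span fr) sE; exact/closuresP. Qed.

(** If [G] is the least member of [L] above [E], the intersections of [E] with
    the members below [G] are spanned and explain all dependencies of [E]. *)
Lemma alpha_closures_new E : sp E -> E \notin L -> (1 < fdim d E)%N ->
  alpha d (closures d X) E = 0.
Proof.
move=> sE nEL E1; have cE := spanned_cf pgd sE.
have EX : E \in closures d X by exact/closuresP.
apply/eqP; rewrite eq_le (alpha_ge0 pgd fld frX EX E1) andbT subr_le0.
pose P n := `[< exists2 G, G \in L & E `<=` G /\ fdim d G = n >].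
have Pex : exists n, P n.
  exists (fdim d (c [set` X])); apply/asboolP; exists (c [set` X]) => //.
    exact: frame_top fr.
  by split=> //; rewrite -[X in X `<=` _]sE; apply: cl_mono => x [].
have [n /asboolP[G GL [EG Gn]] minG] := ex_minnP Pex.
have cG := cL GL.
have neEG : E <> G by move=> eE; move/negP: nEL; rewrite eE.
have G1 : (1 < fdim d G)%N.
  by rewrite (leq_trans E1)// fdim_mono//; case: cG.
have IHG F : F \in below L G ->
    forall E1 E2, E1 `<=` F -> E2 `<=` F -> sp E1 -> sp E2 -> sp (E1 `&` E2).
  by move=> _ E2 E3 _ _; exact: tight_stable.
have cM : all_cf d (meetl (below L G) [:: E]).
  apply: all_cf_meetl => //; first exact: all_cf_below.
  by move=> F; rewrite inE => /eqP->.
have frB : all_cf d (below (closures d X) E).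
  exact/all_cf_below/(frame_cf pgd frX).
apply: le_trans _ (tight1 pgd fr ti GL G1 sE EG neEG).
apply: le_trans _ (Dl_add_spanned pgd fld (X := X) (t := below (closures d X) E) cM _ _).
- rewrite le_eqVlt; apply/orP; left; apply/eqP; apply: Dl_eq => //.
  + exact: all_cf_cat.
  + by apply: dominated_subset => F FB; rewrite mem_cat FB orbT.
  apply: dominated_cat; apply: dominated_subset => //.
  move=> _ /meetlP[F [F' [FA /[!inE]-> ->]]]; apply/belowP; split.
  + apply/(closuresP pgd); exact: (spanned_meet_below pgd fld fr ti GL G1 IHG sE EG neEG FA).
  + by move=> x [].
  + move=> eE; have /belowP[FL FG neFG] := FA.
    have /minG : P (fdim d F).
      by apply/asboolP; exists F => //; split=> //; rewrite -eE => x [].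
    have := cf_lt pgd (cL FL) cG FG neFG; lia.
- by move=> F /belowP[/(closuresP pgd) sF _ _].
- move=> F x /belowP[_ FE _] xX Fx.
  have [F' F'A F'x] := below_pt pgd fr G1 cG.1 xX (EG _ (FE _ Fx)).
  by exists (F' `&` E); [apply: mem_meetl; rewrite ?mem_head|split=> //; exact: FE].
Qed.

Lemma alpha_closures_le G : G \in L -> (1 < fdim d G)%N ->
  alpha d (closures d X) G <= alpha d L G.
Proof.
move=> GL G1; have cG := cL GL; rewrite lerD2r.
have frB : all_cf d (below (closures d X) G).
  exact/all_cf_below/(frame_cf pgd frX).
have frA : all_cf d (below L G) by exact: all_cf_below.
apply: le_trans _ (Dl_add_spanned pgd fld (X := X) (t := below (closures d X) G) frA _ _).
- rewrite le_eqVlt; apply/orP; left; apply/eqP; apply: Dl_eq => //.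
  + exact: all_cf_cat.
  + by apply: dominated_subset => F FB; rewrite mem_cat FB orbT.
  apply: dominated_cat; apply: dominated_subset => //.
  by move=> F /belowP[/LX FX FG neq]; apply/belowP.
- by move=> F /belowP[/(closuresP pgd) sF _ _].
- by move=> F x /belowP[_ FG _] xX /FG; exact: (below_pt pgd fr G1 cG.1 xX).
Qed.

Lemma rank_closures_le r : (rank d (closures d X) r <= rank d L r)%N.
Proof.
rewrite /rank (bigID (mem L))/= [X in (_ + X)%N]big1_seq ?addn0; last first.
  move=> E; rewrite mem_undup => /andP[/andP[/andP[E1 _] nEL] /(closuresP pgd) sE].
  by rewrite alpha_closures_new.
rewrite -big_filter -[leqRHS]big_filter.
rewrite (perm_big [seq E <- undup L | (1 < fdim d E)%N & fdim d E == r])/=; last first.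
  apply: uniq_perm; try exact/filter_uniq/undup_uniq.
  move=> E; rewrite !mem_filter !mem_undup.
  apply/idP/idP => [/andP[/andP[-> ->]]//|/andP[-> EL]].
  by rewrite EL /= LX.
rewrite big_seq [leqRHS]big_seq leq_sum// => E.
rewrite mem_filter mem_undup => /andP[/andP[E1 _] EL].
have := alpha_ge0 pgd fld frX (LX EL) E1; have := alpha_closures_le EL E1; lia.
Qed.

End TightStar.

(** * Tightness and strong embeddings *)

Section Strong.
Variables (M : choiceType) (d : {fset M} -> nat).
Hypotheses (pgd : pregeometry d) (fld : flat d).
Implicit Types (A B X Y : {fset M}) (E F G Z : set M).
Implicit Types (s t u p J : seq (set M)).
Local Notation c := (cl d setT).
Local Open Scope ring_scope.

(** The sets quantified over in [n_embedded] are finite. *)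
Lemma fset_extension X (Y : set M) m : [set` X] `<=` Y ->
  (Y `\` [set` X] #<= `I_m)%card ->
  exists2 B, Y = [set` (X `|` B)%fset] & (#|` B| <= m)%N.
Proof.
move=> XY Ym; exists (fset_set (Y `\` [set` X])); last exact: geq_card_fset_set.
have finY : finite_set (Y `\` [set` X]) by apply/finite_set_leP; exists m.
apply/seteqP; split=> x /=; rewrite in_fsetU in_fset_set//.
  move=> Yx; have [//|nXx] := boolP (x \in X).
  by apply/mem_set; split=> //; exact/negP.
by move=> /orP[/XY//|/set_mem[]].
Qed.

Lemma Delta_Dl k (E : 'I_k -> set M) t : (forall i, cf d (E i)) -> all_cf d t ->
  (forall i, exists2 F, F \in t & E i `<=` F) ->
  (forall F, F \in t -> exists i, F `<=` E i) -> Delta d E = Dl d t.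
Proof.
move=> cE ct Et tE; pose v := [seq E i | i <- enum 'I_k] ++ t.
have cv : all_cf d v by apply: all_cf_cat => // F /mapP[i _ ->].
pose u := undup (meets v).
have uI : meet_stable u by move=> F G; rewrite !mem_undup; exact: meets_closed.
have [|w Hw] := Delta_weights pgd uI _ (undup_uniq _).
  by move=> F; rewrite mem_undup; exact: all_cf_meets.
rewrite /Dl !Hw.
- apply: eq_bigl => F; apply/existsP/existsP => -[i /asboolP Fi].
    have [G Gt EG] := Et i; have /(nthP set0)[j jt jG] := Gt.
    by exists (Ordinal jt); apply/asboolP; rewrite /= jG => x /Fi/EG.
  have [j Ej] := tE _ (mem_nth set0 (ltn_ord i)).
  by exists j; apply/asboolP => x /Fi/Ej.
- by move=> i; rewrite mem_undup; apply: sub_meets; rewrite mem_cat mem_nth ?orbT.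
- move=> i; rewrite mem_undup; apply: sub_meets; rewrite mem_cat; apply/orP; left.
  by apply/mapP; exists i; rewrite ?mem_enum.
Qed.

Lemma Delta_congr (M' : choiceType) (d' : {fset M'} -> nat) k
    (E : 'I_k -> set M) (E' : 'I_k -> set M') :
  (forall s : {set 'I_k}, s != finset.set0 ->
    fdim d (\bigcap_(i in [set j | j \in s]) E i) =
    fdim d' (\bigcap_(i in [set j | j \in s]) E' i)) ->
  Delta d E = Delta d' E'.
Proof. by move=> EE'; apply: eq_bigr => s s0; rewrite EE'. Qed.

(** Taking closures preserves intersections of closed sets of a star-embedded
    set, hence alternating sums. *)
Lemma Delta_cl Y k (E : 'I_k -> set M) : stable_span d Y ->
  (forall i, closed_in d [set` Y] (E i)) ->
  Delta d E = Delta d (fun i => c (E i)).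
Proof.
move=> st cE; apply: Delta_congr => s s0.
have clY i : c (E i) \in closures d Y.
  apply/(closuresP pgd); apply: spanned_cl => //.
  by have /closed_inE[] := cE i.
have := mem_bigcap (frame_meet (frame_closures pgd st)) clY s0.
move=> /(closuresP pgd) <-; rewrite fdim_cl//; last exact: finite_dimIX.
congr (fdim d _); apply/seteqP; split=> x.
  move=> Ex; have [i si] := finset.set0Pn _ s0; split.
    by have /closed_inE[EY _] := cE i; exact/EY/Ex.
  by move=> j sj; apply: sub_cl; exact: Ex.
move=> [Yx Ex] j sj; have /closed_inE[_ <-] := cE j.
by split=> //; exact: Ex.
Qed.

(** The contribution of a maximal member [F] of the down-closed family [p], where
    [p'] is the rest of [p]. *)
Lemma Dl_meet_peel J p p' L F : all_cf d J -> all_cf d L -> meet_stable L ->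
  {subset p <= L} -> F \in p -> (forall H, H \in p' -> H \in p /\ ~ F `<=` H) ->
  (forall H, H \in p -> H = F \/ H \in p') ->
  {subset below L F <= p'} ->
  Dl d (meetl J p) =
  Dl d (meetl J p') + Dl d (meetl J [:: F]) - Dl d (meetl J (below L F)).
Proof.
move=> cJ cL LI pL Fp p'p pp' bp'.
have cF : all_cf d [:: F] by move=> H; rewrite inE => /eqP->; exact/cL/pL.
have cp' : all_cf d p' by move=> H /p'p[/pL/cL].
have cp : all_cf d p by move=> H /pL/cL.
have cJp' := all_cf_meetl pgd cJ cp'; have cJF := all_cf_meetl pgd cJ cF.
transitivity (Dl d (meetl J p' ++ meetl J [:: F])).
  apply: Dl_eq => //; [exact: all_cf_meetl|exact: all_cf_cat| |].
    apply: dominated_subset => _ /meetlP[E [H [EJ /pp'[->|Hp'] ->]]].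
      by rewrite mem_cat [X in _ || X]mem_meetl ?orbT ?mem_head.
    by rewrite mem_cat mem_meetl.
  apply: dominated_cat; apply: dominated_subset.
    by move=> _ /meetlP[E [H [EJ /p'p[Hp _] ->]]]; exact: mem_meetl.
  by move=> _ /meetlP[E [H [EJ /[!inE]-> ->]]]; exact: mem_meetl.
rewrite Dl_cat//; congr (_ - _); apply: Dl_eq => //.
- exact: all_cf_meetl.
- by apply: all_cf_meetl => //; exact: all_cf_below.
- move=> _ /meetlP[_ [_ [/meetlP[E [H [EJ Hp' ->]]]
    /meetlP[E' [F' [E'J + ->]]] ->]]]; rewrite inE => /eqP->.
  have [Hp nFH] := p'p _ Hp'; exists (E `&` (H `&` F)).
    apply: mem_meetl => //; apply/belowP; split.
    + by apply: LI; exact: pL.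
    + by move=> x [].
    + by move=> HF; apply: nFH; rewrite -HF => x [].
  by move=> x [[Ex Hx] [_ Fx]].
- move=> _ /meetlP[E [H [EJ Hb ->]]]; exists ((E `&` H) `&` (E `&` F)).
    by apply: mem_meetl; apply: mem_meetl => //; [exact: bp'|exact: mem_head].
  by have /belowP[_ HF _] := Hb; move=> x [Ex Hx]; do !split=> //; exact: HF.
Qed.

Variable X : {fset M}.
Hypothesis stX : stable_span d X.
Let L := closures d X.
Let frL : frame d X L := frame_closures pgd stX.
Let cL : all_cf d L := frame_cf pgd frL.

(** Compare the two families on ever larger down-closed families of closed sets of
    [X]: a new closed set [F] that lies in no member of [J] is not resolved by its
    intersections with these members. *)
Lemma tight_Dl_le k J : tight d k L -> all_cf d J -> (size J <= k)%N ->
  Dl d [seq c ([set` X] `&` E) | E <- J] <= Dl d J.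
Proof.
move=> ti cJ Jk; set JX := map _ J.
have JXL : {subset JX <= L}.
  by move=> _ /mapP[E _ ->]; apply/(closuresP pgd); apply: spanned_cl => // x [].
have cJX : all_cf d JX by move=> E /JXL/cL.
have top_absorbs J' F (A : seq (set M)) : all_cf d J' -> all_cf d A -> F \in L ->
    (exists2 E, E \in J' & F `<=` E) -> (forall H, H \in A -> H `<=` F) ->
    Dl d (meetl J' A) = Dl d A.
  move=> cJ' cA FL [E EJ FE] AF; apply: Dl_eq => //; first exact: all_cf_meetl.
    by move=> _ /meetlP[E' [H [_ HA ->]]]; exists H => // x [].
  move=> H HA; exists (E `&` H); first exact: mem_meetl.
  by move=> x Hx; split=> //; exact/FE/(AF _ HA).
have step p : {subset p <= L} ->
    (forall F F', F \in p -> F' \in L -> F' `<=` F -> F' \in p) ->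
    Dl d (meetl JX p) <= Dl d (meetl J p).
  have [n] := ubnP (size p); elim: n p => // n IH p pn pL pdown.
  have [->|/(seq_max (fdim d))[F Fp Fmax]] := eqVneq p [::].
    have nil J' : meetl J' [::] = [::] :> seq (set M) by elim: J'.
    by rewrite !nil.
  have FL := pL _ Fp; have cF := cL FL; pose p' := [seq H <- p | H != F].
  have not_above H : H \in p -> H <> F -> ~ F `<=` H.
    move=> Hp neq FH; have := cf_lt pgd cF (cL (pL _ Hp)) FH (nesym neq).
    by rewrite ltnNge Fmax.
  have p'p H : H \in p' -> H \in p /\ ~ F `<=` H.
    by rewrite mem_filter => /andP[/eqP neq Hp]; split=> //; exact: not_above.
  have pp' H : H \in p -> H = F \/ H \in p'.
    move=> Hp; have [->|neq] := eqVneq H F; first by left.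
    by right; rewrite mem_filter neq.
  have bp' : {subset below L F <= p'}.
    by move=> H /belowP[HL HF neq]; have [|//|//] := pp' H; exact: pdown HF.
  have cA : all_cf d (below L F) by exact: all_cf_below.
  have cF1 : all_cf d [:: F] by move=> H; rewrite inE => /eqP->.
  have LI := frame_meet frL.
  rewrite (Dl_meet_peel cJX cL LI pL Fp p'p pp' bp').
  rewrite (Dl_meet_peel cJ cL LI pL Fp p'p pp' bp').
  have {}IH : Dl d (meetl JX p') <= Dl d (meetl J p').
    apply: IH.
    - exact: leq_trans (size_filter_neq Fp) pn.
    - by move=> H /p'p[/pL].
    - move=> H H' /p'p[Hp nFH] H'L H'H; have [|eH'|//] := pp' H'.
        exact: pdown H'H.
      by case: nFH; rewrite -eH'.
  suff : Dl d (meetl JX [:: F]) - Dl d (meetl JX (below L F)) <=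
      Dl d (meetl J [:: F]) - Dl d (meetl J (below L F)).
    by move=> JF; rewrite -!addrA lerD.
  have F_sub H : H \in [:: F] -> H `<=` F by rewrite inE => /eqP->.
  have A_sub H : H \in below L F -> H `<=` F by move=> /belowP[].
  have [[E EJ FE]|nFJ] := pselect (exists2 E, E \in J & F `<=` E).
    have FJ : exists2 E, E \in J & F `<=` E by exists E.
    have FJX : exists2 E, E \in JX & F `<=` E.
      exists (c ([set` X] `&` E)); first by apply/mapP; exists E.
      rewrite -[X in X `<=` _](frame_span frL FL).
      by apply: cl_mono => x [Xx /FE].
    by rewrite !(@top_absorbs _ F)//; move=> H; rewrite ?inE => /eqP->.
  have JF_prop E : E \in J -> E `&` F <> F.
    by move=> EJ eF; apply: nFJ; exists E; rewrite // -eF => x [].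
  have JX_below : Dl d (meetl JX [:: F]) = Dl d (meetl JX (below L F)).
    apply: Dl_eq => //; try exact: all_cf_meetl.
      move=> _ /meetlP[E' [F' [E'J + ->]]]; rewrite inE => /eqP->.
      have /mapP[E EJ eE'] := E'J; exists (E' `&` (E' `&` F)).
        apply: mem_meetl => //; apply/belowP; split.
        - by apply: LI => //; exact: JXL.
        - by move=> x [].
        - move=> eF; apply: (JF_prop E) => //; apply/seteqP; split=> [x []//|].
          move=> x Fx; split=> //; move: Fx; rewrite -eF eE' => -[+ _].
          by apply: (cl_sub (cJ _ EJ).1) => y [].
      by move=> x [Ex Fx].
    move=> _ /meetlP[E' [H [E'J /belowP[_ HF _] ->]]]; exists (E' `&` F).
      by apply: mem_meetl; rewrite ?mem_head.
    by move=> x [Ex /HF].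
  have cJF := all_cf_meetl pgd cJ cF1.
  have := ti F (meetl J [:: F]) FL.
  rewrite size_allpairs muln1 => /(_ Jk) tiF.
  have {tiF} : Dl d (below L F) <= Dl d (below L F ++ meetl J [:: F]).
    apply: tiF => S SJ; split; first exact: cJF.
      by have /meetlP[E [F' [_ + ->]]] := SJ; rewrite inE => /eqP-> x [].
    have /meetlP[E [F' [EJ + ->]]] := SJ; rewrite inE => /eqP->.
    exact: JF_prop.
  rewrite Dl_cat//.
  have -> : Dl d (meetl (below L F) (meetl J [:: F])) = Dl d (meetl J (below L F)).
    apply: Dl_eq => //; try exact: all_cf_meetl.
      move=> _ /meetlP[H [K [HA /meetlP[E [F' [EJ _ ->]]] ->]]].
      by exists (E `&` H); [exact: mem_meetl|move=> x [Hx []]].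
    move=> _ /meetlP[E [H [EJ HA ->]]]; exists (H `&` (E `&` F)).
      by apply: mem_meetl => //; apply: mem_meetl; rewrite ?mem_head.
    by have /belowP[_ HF _] := HA; move=> x [Ex Hx]; do !split=> //; exact: HF.
  by rewrite JX_below subrr -addrA lerDl.
have topL := frame_top frL; have cT := cL topL.
have cT1 : all_cf d [:: c [set` X]] by move=> H; rewrite inE => /eqP->.
have sub_top H : H \in L -> H `<=` c [set` X].
  by move=> /(frame_span frL) <-; apply: cl_mono => x [].
have JXE : Dl d JX = Dl d (meetl JX L).
  apply: Dl_eq => //; first exact: all_cf_meetl.
    by move=> E EJ; exists (E `&` E); [apply: mem_meetl => //; exact: JXL|].
  by move=> _ /meetlP[E [H [EJ _ ->]]]; exists E => // x [].
rewrite JXE; apply: le_trans (step L _ _) _ => //.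
have -> : Dl d (meetl J L) = Dl d (meetl J [:: c [set` X]]).
  apply: Dl_eq => //; try exact: all_cf_meetl.
    move=> _ /meetlP[E [H [EJ HL ->]]]; exists (E `&` c [set` X]).
      by apply: mem_meetl; rewrite ?mem_head.
    by move=> x [Ex /(sub_top _ HL)].
  move=> _ /meetlP[E [H [EJ + ->]]]; rewrite inE => /eqP->.
  by exists (E `&` c [set` X]) => //; exact: mem_meetl.
have : (fdim d (c [set` X]))%:Z <= Dl d (J ++ [:: c [set` X]]).
  apply: (fdim_le_Dl pgd fld _ (frame_span frL topL)); first exact: all_cf_cat.
  by move=> x _ Tx; exists (c [set` X]); rewrite // mem_cat mem_head orbT.
by rewrite Dl_cat1//; lia.
Qed.

Lemma tight_strong Y : stable_span d Y -> (X `<=` Y)%fset ->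
  tight d (2 ^ #|` Y|) L -> strongly_embedded d [set` X] [set` Y].
Proof.
move=> stY /fsubsetP XY ti; split=> [x /XY//|k E cE].
have {}cE i : closed_in d [set` Y] (E i) by case: (cE i).
have cEX i : closed_in d [set` X] (E i `&` [set` X]).
  apply/closed_inE; split=> [x []//|]; apply/seteqP; split=> x.
    move=> [Xx Ex]; split=> //; have /closed_inE[_ <-] := cE i.
    by split; [exact: XY|apply: cl_mono Ex => y []].
  by move=> [Ex Xx]; split=> //; exact: sub_cl.
rewrite (Delta_cl stX cEX) (Delta_cl stY cE).
have sY i : spanned d [set` Y] (c (E i)).
  by apply: spanned_cl => //; have /closed_inE[] := cE i.
pose J := undup [seq c (E i) | i <- enum 'I_k].
have inJ i : c (E i) \in J.
  by rewrite mem_undup; apply/mapP; exists i; rewrite ?mem_enum.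
have JY : {subset J <= closures d Y}.
  by move=> F; rewrite mem_undup => /mapP[i _ ->]; exact/(closuresP pgd).
have cJ : all_cf d J.
  by move=> F /JY/(closuresP pgd)/spanned_cf; apply.
have XE i : c (E i `&` [set` X]) = c ([set` X] `&` c (E i)).
  congr (c _); apply/seteqP; split=> x [Ex Xx]; split=> //; first exact: sub_cl.
  by have /closed_inE[_ <-] := cE i; split=> //; exact: XY.
have JE F : F \in J -> exists i, F = c (E i).
  by rewrite mem_undup => /mapP[i _ ->]; exists i.
rewrite (@Delta_Dl _ (fun i => c (E i)) J)//; first last.
- by move=> F /JE[i ->]; exists i.
- by move=> i; exists (c (E i)).
- by move=> i; exact: cJ.
have cX i : cf d (c (E i `&` [set` X])).
  by apply: cf_cl => //; rewrite setIC; exact: finite_dimIX.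
rewrite (@Delta_Dl _ (fun i => c (E i `&` [set` X]))
  [seq c ([set` X] `&` F) | F <- J])//; first last.
- by move=> _ /mapP[F /JE[i ->] ->]; exists i; rewrite XE.
- by move=> i; exists (c ([set` X] `&` c (E i))); rewrite ?XE//;
     apply/mapP; exists (c (E i)).
- by move=> _ /mapP[F /JE[i ->] ->]; rewrite -XE.
apply: (tight_Dl_le ti cJ); rewrite -(size_closures d Y).
exact: uniq_leq_size (undup_uniq _) JY.
Qed.

(** The families that test strong embeddings into a set [Y] with at most [m] new
    elements have at most [2 ^ (#|` X| + m)] members. *)
Lemma tight_n_embedded m :
  tight d (2 ^ (#|` X| + m)) L -> n_embedded d m [set` X].
Proof.
move=> ti; split; first exact/star_embeddedP.
move=> Y XY stY /(fset_extension XY)[B eY Bm].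
rewrite eY in stY *; apply: tight_strong; first exact/star_embeddedP.
- exact: fsubsetUl.
move=> G s GL sk; apply: ti => //; apply: leq_trans sk _.
by rewrite leq_exp2l//; have := cardfsU X B; lia.
Qed.

End Strong.

(** * Bounded descent along ranks *)

Lemma lt_lex_eq D r1 r1' r2 r2' : (forall t, t <= D -> r1 t = r1' t) ->
  (forall t, t <= D -> r2 t = r2' t) -> lt_lex D r1 r2 -> lt_lex D r1' r2'.
Proof.
move=> e1 e2 [s [sD ltr eqr]]; exists s; split=> //; first by rewrite -e1 -?e2.
by move=> t /andP[st tD]; rewrite -e1 -?e2// eqr// st.
Qed.

(** Consider the largest argument at which [r1] and [r] differ. *)
Lemma le_lt_lex D r1 r2 r : (forall t, r1 t <= r2 t) ->
  lt_lex D r2 r -> lt_lex D r1 r.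
Proof.
move=> le12 [s [sD ltr eqr]].
pose P t := (t <= D) && (r1 t != r t).
have Ps : P s by rewrite /P sD ltn_eqF// (leq_ltn_trans (le12 s)).
have Pb t : P t -> t <= D by case/andP.
have [t /andP[tD neq] maxt] := ex_maxnP (ex_intro _ s Ps) Pb.
exists t; split=> // [|u /andP[tu uD]].
  rewrite ltn_neqAle neq (leq_trans (le12 t))//.
  have := maxt _ Ps; rewrite leq_eqVlt => /orP[/eqP<-|st]; first exact: ltnW.
  by rewrite eqr// st.
apply/eqP; apply: contraTT isT => ru.
by have := maxt u; rewrite /P uD ru leqNgt tu => /(_ isT).
Qed.

Lemma lt_lex_trans D r1 r2 r3 :
  lt_lex D r1 r2 -> lt_lex D r2 r3 -> lt_lex D r1 r3.
Proof.
move=> [s [sD lts eqs]] [t [tD ltt eqt]].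
have [st|ts|est] := ltngtP s t.
- exists t; split=> // [|u /andP[tu uD]]; first by rewrite eqs// st.
  by rewrite eqs ?eqt ?tu// (ltn_trans st).
- exists s; split=> // [|u /andP[su uD]]; first by rewrite -eqt// ts.
  by rewrite eqs ?eqt ?su// (ltn_trans ts).
- exists s; split=> // [|u /andP[su uD]].
    by rewrite (ltn_trans lts)// est.
  by rewrite eqs ?eqt -?est ?su.
Qed.

Lemma wf_lt_lex D : well_founded (lt_lex D).
Proof.
have wf0 m (P : Prop) : m < 0 -> P by [].
elim: D => [r|D IH r].
  have [n] := ubnP (r 0); elim: n r => [r|n IH r rn];
    first exact: (@wf0 _ _).
  constructor=> r' [s [s0 ltr _]]; apply: IH.
  move: s0 ltr; rewrite leqn0 => /eqP-> ltr; exact: leq_trans ltr rn.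
have [n] := ubnP (r D.+1); elim: n r => [r|n IHn r];
    first exact: (@wf0 _ _).
elim/(well_founded_ind IH): r => r IHr rn; constructor=> r' [s [sD ltr eqr]].
move: sD; rewrite leq_eqVlt => /orP[/eqP eD|sD].
  by apply: IHn; rewrite eD in ltr; exact: leq_trans ltr rn.
have eD : r' D.+1 = r D.+1 by rewrite eqr// sD /=.
apply: IHr; last by rewrite eD.
exists s; split=> // t /andP[st tD]; apply: eqr.
by rewrite st ltnW.
Qed.

(** States [x] have a size and a rank; [b] bounds the size after one step.  The
    condition [Q K x] and the conclusion [Goal K x] involve a bound [K], which has
    to be found in advance. *)
Section Descent.
Variables (St : Type) (sz : St -> nat) (rk : St -> nat -> nat) (D : nat).
Variables (b cb : nat -> nat) (Q Goal : nat -> St -> Prop).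
Hypothesis rk_bound : forall x s, rk x s <= cb (sz x).
Hypothesis Q_anti : forall K K' x, K <= K' -> Q K' x -> Q K x.
Hypothesis Goal_mono : forall K K' x, K <= K' -> Goal K x -> Goal K' x.
Hypothesis step : forall x, Q (b (sz x)) x -> Goal (b (sz x)) x \/
  exists x', [/\ sz x' <= b (sz x), lt_lex D (rk x') (rk x),
    forall K, Q K x -> Q K x' & forall K, Goal K x' -> Goal K x].

Let upto (f : nat -> nat) n := \max_(i < n.+1) f i.

Let leq_upto f i n : i <= n -> f i <= upto f n.
Proof. by rewrite -ltnS => lin; exact: (@leq_bigmax _ _ (Ordinal lin)). Qed.

Let of_ffun C (f : {ffun 'I_D.+1 -> 'I_C.+1}) t : nat := f (inord t).

Let of_ffunP C r : (forall s, r s <= C) ->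
  exists f : {ffun 'I_D.+1 -> 'I_C.+1}, forall t, t <= D -> of_ffun f t = r t.
Proof.
move=> rC; exists [ffun i : 'I_D.+1 => inord (r i)] => t tD.
by rewrite /of_ffun ffunE !inordK ?ltnS.
Qed.

(** By induction on the rank: the next rank is bounded in terms of the size, so it
    is one of finitely many. *)
Lemma bounded_descent n : exists B, forall x, sz x <= n -> Q B x -> Goal B x.
Proof.
have fixed r : forall n, exists B, forall x, sz x <= n ->
    (forall s, s <= D -> rk x s = r s) -> Q B x -> Goal B x.
  elim/(well_founded_ind (@wf_lt_lex D)): r => r IH {}n.
  have /choice[Bf HBf] : forall f : {ffun 'I_D.+1 -> 'I_(upto cb (upto b n)).+1},
      exists B, lt_lex D (of_ffun f) r -> forall x, sz x <= upto b n ->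
        (forall s, s <= D -> rk x s = of_ffun f s) -> Q B x -> Goal B x.
    move=> f; have [/IH/(_ (upto b n))[B HB]|nlt] := pselect (lt_lex D (of_ffun f) r).
      by exists B.
    by exists 0.
  exists (maxn (upto b n) (\max_f Bf f)) => x xn rx QB.
  have bx : b (sz x) <= upto b n by exact: leq_upto.
  have [|Gx|[x' [x'b ltx QQ GG]]] := step (x := x).
  - by apply: Q_anti QB; rewrite leq_max bx.
  - by apply: Goal_mono Gx; rewrite leq_max bx.
  have sx' : sz x' <= upto b n by exact: leq_trans bx.
  have [|f fE] := @of_ffunP (upto cb (upto b n)) (rk x').
    by move=> s; rewrite (leq_trans (rk_bound _ _))// leq_upto.
  have Bfle : Bf f <= maxn (upto b n) (\max_f Bf f).
    by rewrite leq_max leq_bigmax orbT.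
  apply: (Goal_mono Bfle); apply: GG; apply: HBf => //.
  - by apply: lt_lex_eq ltx => t tD; rewrite ?fE ?rx.
  - by move=> s sD; rewrite fE.
  - exact/QQ/(Q_anti Bfle).
have /choice[Bf HBf] : forall f : {ffun 'I_D.+1 -> 'I_(upto cb n).+1},
    exists B, forall x, sz x <= n ->
      (forall s, s <= D -> rk x s = of_ffun f s) -> Q B x -> Goal B x.
  by move=> f; exact: fixed.
exists (\max_f Bf f) => x xn QB.
have [|f fE] := @of_ffunP (upto cb n) (rk x).
  by move=> s; rewrite (leq_trans (rk_bound _ _))// leq_upto.
have Bfle : Bf f <= \max_f Bf f by exact: leq_bigmax.
apply: (Goal_mono Bfle); apply: HBf => // [s sD|]; first by rewrite fE.
exact: Q_anti Bfle QB.
Qed.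

End Descent.

(** * Bounded extensions to star-embedded sets *)

Section RankBound.
Variables (M : choiceType) (d : {fset M} -> nat).
Hypotheses (pgd : pregeometry d) (fld : flat d).
Implicit Types (X : {fset M}) (E F G : set M) (s L : seq (set M)).
Local Open Scope ring_scope.

Lemma Dl_le n s : all_cf d s -> (forall E, E \in s -> (fdim d E <= n)%N) ->
  Dl d s <= (2 ^ size s * n)%N%:Z.
Proof.
move=> cs sn; have -> : (2 ^ size s * n)%N%:Z = \sum_(I : {set 'I_(size s)}) n%:Z.
  rewrite sumr_const -finset.cardsT -powersetT card_powerset finset.cardsT card_ord.
  by rewrite -mulr_natr natz -PoszM mulnC.
rewrite /Dl /Delta [X in _ <= X](bigID (fun I => I != finset.set0))/=.
rewrite -[leLHS]addr0 lerD ?sumr_ge0// ler_sum// => I /finset.set0Pn[i Ii].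
have sign_le (k m : nat) : (m <= n)%N -> (-1) ^+ k * m%:Z <= n%:Z.
  by move=> mn; rewrite -signr_odd; case: (odd k); rewrite ?expr1 ?expr0; lia.
apply: sign_le; have is' := mem_nth set0 (ltn_ord i).
apply: leq_trans (sn _ is'); apply: fdim_mono => //; first by case: (cs _ is').
by move=> x; apply.
Qed.

Lemma rank_le X L r : frame d X L ->
  (rank d L r <= size L * (2 ^ size L * #|` X|))%N.
Proof.
move=> fr; have cL := frame_cf pgd fr.
apply: (@leq_trans (\sum_(G <- undup L) 2 ^ size L * #|` X|)%N).
  rewrite /rank big_mkcond/= big_seq [leqRHS]big_seq leq_sum// => G.
  rewrite mem_undup => GL; case: ifP => // /andP[G1 _].
  have a0 := alpha_ge0 pgd fld fr GL G1.
  have : Dl d (below L G) <= (2 ^ size (below L G) * #|` X|)%N%:Z.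
    apply: Dl_le; first exact: all_cf_below.
    move=> F /belowP[FL _ _]; apply: leq_trans (frame_dim pgd fr FL) _.
    exact: dim_card.
  have : (2 ^ size (below L G) * #|` X| <= 2 ^ size L * #|` X|)%N.
    rewrite leq_mul2r leq_exp2l//; apply/orP; right.
    exact: size_subseq (filter_subseq _ _).
  by move: a0; rewrite /alpha; lia.
rewrite big_const_seq count_predT iter_addn_0 mulnC leq_mul2r.
by rewrite size_undup orbT.
Qed.

End RankBound.

Record framed := Framed {
  fr_M : choiceType;
  fr_d : {fset fr_M} -> nat;
  fr_X : {fset fr_M};
  fr_L : seq (set fr_M);
  fr_flat : flat_pregeometry fr_d;
  fr_frame : frame fr_d fr_X fr_L }.

Lemma dim_cl_eq (M : choiceType) (d : {fset M} -> nat) (X Y : {fset M}) :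
  pregeometry d -> cl d setT [set` X] = cl d setT [set` Y] -> d X = d Y.
Proof.
move=> pgd clXY; have e Z := fdim_cl pgd (finite_dim_fset pgd Z).
by rewrite -(fdim_fset pgd X) -(fdim_fset pgd Y) -(e X) -(e Y) clXY.
Qed.

Lemma not_tight (M : choiceType) (d : {fset M} -> nat) k L : ~ tight d k L ->
  exists G s, [/\ G \in L, size s <= k,
    forall S, S \in s -> [/\ cf d S, S `<=` G & S <> G] &
    (Dl d (below L G ++ s) < Dl d (below L G))%R].
Proof.
move=> nt; apply: contrapT => nex; apply: nt => G s GL sk sP.
by rewrite leNgt; apply/negP => lt; apply: nex; exists G, s.
Qed.

(** Resolve members by pairs of closed sets as long as possible: each resolution
    lowers the rank, and increases the size by a bounded amount.  The rank
    condition is stated through its consequences, as the frame may be tight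
    already. *)
Lemma tighten D n : exists B, forall (M : choiceType) (d : {fset M} -> nat) X L,
  flat_pregeometry d -> frame d X L -> d X <= D -> #|` X| + size L <= n ->
  exists X' L', [/\ frame d X' L' /\ tight d 2 L', (X `<=` X')%fset,
    d X' = d X, #|` X'| <= B &
    forall r, lt_lex D (rank d L) r -> lt_lex D (rank d L') r].
Proof.
pose b j := 2 ^ (j + 2) * j + 2 ^ (j + 2) * j + 2 ^ (j + 2) + j + j.
have [||||B HB] := @bounded_descent framed (fun x => #|` fr_X x| + size (fr_L x))
  (fun x => rank (@fr_d x) (fr_L x)) D b
  (fun j => j * (2 ^ j * j))
  (fun _ x => fr_d (fr_X x) <= D)
  (fun K x => exists X' L', [/\ frame (@fr_d x) X' L' /\ tight (@fr_d x) 2 L',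
    (fr_X x `<=` X')%fset, fr_d X' = fr_d (fr_X x), #|` X'| <= K &
    forall r, lt_lex D (rank (@fr_d x) (fr_L x)) r ->
      lt_lex D (rank (@fr_d x) L') r]) _ _ _ _ n.
- move=> [M d X L [pgd fld] fr] r /=; apply: leq_trans (rank_le pgd fld r fr) _.
  by rewrite leq_mul ?leq_addl// leq_mul ?leq_addr// leq_exp2l ?leq_addl.
- by [].
- by move=> K K' x KK' [X' [L' [? ? ? /leq_trans/(_ KK') ? ?]]]; exists X', L'.
- case=> M d X L fl fr /= XD; have [pgd fld] := fl.
  have [ti|/not_tight[G [s [GL s2 sP ltG]]]] := pselect (tight d 2 L).
    by left; exists X, L; split=> //; rewrite /b; lia.
  right; have [X' [L' [fr' [XX' clX] X'b L'b ltr]]] :=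
    resolve pgd fld fr GL sP ltG XD.
  have dX := dim_cl_eq pgd clX; exists (Framed fl fr'); split=> //=.
  + have le2 : 2 ^ (size L + size s) <= 2 ^ (#|` X| + size L + 2).
      by rewrite leq_exp2l//; lia.
    have leX := leq_mul le2 (leq_addr (size L) #|` X|).
    move: X'b L'b leX le2; rewrite /b.
    by move: (2 ^ (size L + size s)) (2 ^ (_ + 2)) => u v; lia.
  + by rewrite dX.
  + move=> K [X2 [L2 [frt X'X2 dX2 X2K lt2]]]; exists X2, L2; split=> //.
    * exact: fsubset_trans X'X2.
    * by rewrite dX2.
    * by move=> r ltLr; apply/lt2/(lt_lex_trans ltr).
exists B => M d X L fl fr XD sz; exact: (HB (Framed fl fr) sz XD).
Qed.

(** Make the frame tight; the lattice of closed sets of its points has no larger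
    rank. *)
Lemma extend_to_star D n : exists B, forall (M : choiceType) (d : {fset M} -> nat)
    X L, flat_pregeometry d -> frame d X L -> d X <= D -> #|` X| + size L <= n ->
  exists X', [/\ (X `<=` X')%fset, stable_span d X', d X' = d X, #|` X'| <= B &
    forall r, lt_lex D (rank d L) r -> lt_lex D (rank d (closures d X')) r].
Proof.
have [B HB] := tighten D n; exists B => M d X L fl fr XD sz.
have [pgd fld] := fl.
have [X' [L' [[fr' ti] XX' dX' X'B ltr]]] := HB _ _ _ _ fl fr XD sz.
exists X'; split=> //; first exact: tight_stable fr' ti.
move=> r /ltr; apply: le_lt_lex => t; exact: rank_closures_le fr' ti t.
Qed.

Lemma frame_points (M : choiceType) (d : {fset M} -> nat) (A : {fset M}) :
  pregeometry d -> exists2 L, frame d A L & size L <= #|` A| + 2.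
Proof.
move=> pgd; pose c := cl d setT.
exists [:: c set0, c [set` A] & [seq c [set x] | x <- A]]; last first.
  by rewrite /= size_map; lia.
set L := [:: _, _ & _].
have cA E : E \in L -> cf d E /\ E `<=` c [set` A].
  rewrite !inE => /or3P[/eqP->|/eqP->|/mapP[x xA ->]].
  - by split; [exact: cf_bot|exact: cl_mono].
  - by split=> //; apply: cf_cl => //; exact: finite_dim_fset.
  - by split; [exact: cf_cl1|apply: cl_mono => y ->].
have bot : c set0 \in L by rewrite mem_head.
have ptL x : x \in A -> c [set x] \in L.
  by move=> xA; rewrite !inE; apply/or3P/Or33/mapP; exists x.
have ptI x E : x \in A -> E \in L -> c [set x] `&` E \in L.
  move=> xA /cA[cE _]; have [->|->] := cl1_meet pgd x cE => //; exact: ptL.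
split=> //.
- move=> E; rewrite !inE => /or3P[/eqP->|/eqP->|/mapP[x xA ->]].
  + exact: spanned_cl.
  + exact: spanned_cl.
  + by apply: spanned_cl => // y ->.
- move=> E F EL FL; have [cE EA] := cA E EL; have [cF FA] := cA F FL.
  move: (EL); rewrite !inE => /or3P[/eqP->|/eqP->|/mapP[x xA ->]].
  + by rewrite (setIidl (bot_sub cF)).
  + by rewrite (setIidr FA).
  + exact: ptI.
- by rewrite !inE eqxx orbT.
Qed.

Lemma star_superset n : exists B, forall (M : choiceType) (d : {fset M} -> nat) A,
  flat_pregeometry d -> #|` A| <= n ->
  exists X, [/\ (A `<=` X)%fset, stable_span d X, d X = d A & #|` X| <= B].
Proof.
have [B HB] := extend_to_star n (n + (n + 2)).
exists B => M d A fl An; have [pgd _] := fl.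
have [L fr sL] := frame_points A pgd.
have [||X [AX st dX XB _]] := HB M d A L fl fr; last by exists X.
  exact: leq_trans (dim_card pgd A) An.
by lia.
Qed.

(** The lattice of closed sets of [X] is a frame that is not tight: resolve one of
    its members, and make the result star-embedded again. *)
Lemma star_descent m D n : exists B, forall (M : choiceType)
    (d : {fset M} -> nat) X,
  flat_pregeometry d -> stable_span d X -> d X <= D -> #|` X| <= n ->
  ~ n_embedded d m [set` X] ->
  exists X', [/\ (X `<=` X')%fset, stable_span d X', d X' = d X, #|` X'| <= B &
    lt_lex D (rank d (closures d X')) (rank d (closures d X))].
Proof.
pose N := 2 ^ n + 2 ^ (n + m).
have [B HB] := extend_to_star D ((n + 2 ^ N * n) + (2 ^ N + (n + 2 ^ N * n))).
exists B => M d X fl st XD Xn nemb; have [pgd fld] := fl.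
have /not_tight[G [s [GL sk sP ltG]]] :
    ~ tight d (2 ^ (#|` X| + m)) (closures d X).
  by move=> /(tight_n_embedded pgd fld st).
have [X1 [L1 [fr1 [XX1 clX] X1b L1b ltr]]] :=
  resolve pgd fld (frame_closures pgd st) GL sP ltG XD.
have dX1 := dim_cl_eq pgd clX.
have le2 : 2 ^ (size (closures d X) + size s) <= 2 ^ N.
  rewrite leq_exp2l// size_closures leq_add ?leq_exp2l//.
  by rewrite (leq_trans sk)// leq_exp2l// leq_add2r.
have leX := leq_mul le2 Xn.
have [||X' [X1X' st' dX' X'B lt']] := HB _ _ _ _ fl fr1.
- by rewrite dX1.
- move: X1b L1b leX le2 Xn.
  by move: (2 ^ (size _ + size s)) (2 ^ N) => u v; lia.
exists X'; split=> //; first exact: fsubset_trans X1X'.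
- by rewrite dX'.
- exact: lt'.
Qed.

(** * Partial isomorphisms *)

Section Images.
Variables (M N : choiceType).
Implicit Types (A B : {fset M}) (f : M -> N).

Definition im f A : {fset N} := [fset f x | x in A]%fset.

Lemma imP f A y : reflect (exists2 x, x \in A & y = f x) (y \in im f A).
Proof. exact: imfsetP. Qed.

Lemma mem_im f A x : x \in A -> f x \in im f A.
Proof. by move=> xA; apply/imP; exists x. Qed.

Lemma set_im f A : [set` im f A] = f @` [set` A].
Proof.
apply/seteqP; split=> y /=; first by move=> /imP[x xA ->]; exists x.
by move=> [x xA <-]; exact: mem_im.
Qed.

Lemma im_sub f A B : (A `<=` B)%fset -> (im f A `<=` im f B)%fset.
Proof.
move=> /fsubsetP AB; apply/fsubsetP => _ /imP[x /AB xB ->]; exact: mem_im.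
Qed.

Lemma im_add f x A : im f (x |` A)%fset = (f x |` im f A)%fset.
Proof. exact: imfsetU1. Qed.

Lemma card_im_in f A : {in A &, injective f} -> #|` im f A| = #|` A|.
Proof. by move=> finj; rewrite /im card_in_imfset. Qed.

Lemma im_ext f g A : {in A, f =1 g} -> im f A = im g A.
Proof.
by move=> fg; apply/fsetP => y; apply/imP/imP => -[x xA ->]; exists x;
  rewrite ?fg.
Qed.

End Images.

Lemma im_comp (M N K : choiceType) (f : M -> N) (g : N -> K) A :
  im g (im f A) = im (g \o f) A.
Proof.
apply/fsetP => z; apply/imP/imP => [[_ /imP[x xA ->] ->]|[x xA ->]].
  by exists x.
by exists (f x); first exact: mem_im.
Qed.

Lemma im_id (M : choiceType) (f : M -> M) A : {in A, f =1 id} -> im f A = A.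
Proof.
move=> fid; apply/fsetP => x; apply/imP/idP => [[y yA ->]|xA].
  by rewrite fid.
by exists x; rewrite ?fid.
Qed.

(** ** Embeddings of pregeometries *)

Section Embeddings.
Variables (H M : choiceType) (h : {fset H} -> nat) (d : {fset M} -> nat).
Variable f : H -> M.
Hypothesis emb : pg_embedding h d f.
Implicit Types (E F : set H) (A B : {fset H}).

Let finj : injective f := emb.1.
Let fE A : d (im f A) = h A := emb.2 A.

Lemma emb_preim E (B : {fset M}) : [set` B] `<=` f @` E ->
  exists2 A, [set` A] `<=` E & B = im f A.
Proof.
elim/finSet_rect: B => B IH.
have [->|/fset0Pn[y yB]] := eqVneq B fset0.
  exists fset0; first by move=> x; rewrite /= inE.
  by apply/fsetP => y; apply/idP/imP => [|[x]]; rewrite inE.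
move=> BE; have [x Ex xy] := BE y yB.
have [|A AE BA] := IH _ (fproperD1 yB).
  by move=> z /fsetD1P[_ /BE].
exists (x |` A)%fset; first by move=> z /fset1UP[->|/AE].
by rewrite im_add -BA xy fsetD1K.
Qed.

Lemma emb_has_dim E n : has_dim h E n <-> has_dim d (f @` E) n.
Proof.
have sub_im A : [set` im f A] `<=` f @` E <-> [set` A] `<=` E.
  rewrite set_im; split=> [AE x xA|AE _ [x xA <-]]; last by exists x => //; exact: AE.
  by have [|y Ey /finj<-] := AE (f x); first by exists x.
have cardf A : #|` im f A| = #|` A| by apply: card_im_in => x y _ _; exact: finj.
have indf A : independent d (im f A) <-> independent h A.
  by rewrite /independent fE cardf.
split=> -[[A [AE iA An]] maxn]; split.
- by exists (im f A); split; [exact/sub_im|exact/indf|rewrite cardf].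
- move=> B BE iB; have [C CE eB] := emb_preim BE.
  by rewrite eB cardf maxn//; apply/indf; rewrite -eB.
- have [C CE eA] := emb_preim AE; exists C; split=> //.
    by apply/indf; rewrite -eA.
  by rewrite -cardf -eA.
- by move=> B BE iB; rewrite -cardf maxn//; [exact/sub_im|exact/indf].
Qed.

Lemma emb_fdim E : fdim h E = fdim d (f @` E).
Proof.
by rewrite /fdim; congr xget; apply/seteqP; split=> n /emb_has_dim.
Qed.

Lemma emb_finite_dim E : finite_dim h E <-> finite_dim d (f @` E).
Proof. by split=> -[n hn]; exists n; exact/emb_has_dim. Qed.

Lemma emb_Delta k (E : 'I_k -> set H) : Delta h E = Delta d (fun i => f @` E i).
Proof.
apply: Delta_congr => s /finset.set0Pn[i si]; rewrite emb_fdim.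
congr (fdim d _); apply/seteqP; split=> [_ [x Ex <-] j sj|y Ey].
  by exists x => //; exact: Ex.
have [x Ex xy] := Ey i si; exists x => // j sj.
by have [z Ez] := Ey j sj; rewrite -xy => /finj<-.
Qed.

Lemma emb_closed E : closed_in h setT E -> closed_in d (range f) (f @` E).
Proof.
move=> [_ cE]; apply/closed_inE; split; first by move=> _ [x _ <-]; exists x.
apply/seteqP; split=> [_ [[x _ <-] [_ [B BE dB]]]|_ [x Ex <-]].
  have [A AE eB] := emb_preim BE; exists x => //; rewrite -cE; split=> //.
  by exists A => //; rewrite -!fE im_add -eB.
by split; [exists x|apply: sub_cl; exists x].
Qed.

Lemma emb_pregeometry : pregeometry d -> pregeometry h.
Proof.
move=> [d0 d1 dU]; split.
- have im0 : im f fset0 = fset0 by exact: imfset0.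
  by rewrite -fE im0.
- by move=> A x; rewrite -!fE im_add; exact: d1.
- move=> A B; rewrite -!fE.
  have -> : im f (A `|` B)%fset = (im f A `|` im f B)%fset by exact: imfsetU.
  have -> : im f (A `&` B)%fset = (im f A `&` im f B)%fset.
    by apply: imfsetI => x y _ _; exact: finj.
  exact: dU.
Qed.

(** A finite subset need not inherit flatness; a star-embedded one does, as taking
    closures does not change the alternating sums. *)
Lemma emb_flat (X : {fset M}) : pregeometry d -> flat d -> stable_span d X ->
  range f = [set` X] -> flat h.
Proof.
move=> pgd fld st fX k E cE; rewrite emb_fdim emb_Delta.
have clE i : closed_in d [set` X] (f @` E i).
  by rewrite -fX; apply: emb_closed; case: (cE i).
have finE i : finite_dim d (f @` E i) by apply/emb_finite_dim; case: (cE i).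
rewrite (Delta_cl pgd st clE).
have /fld : closed_family d setT (fun i => cl d setT (f @` E i)).
  by move=> i; have [cE' fE'] := cf_cl pgd (finE i); split.
apply: le_trans; rewrite lez_nat; apply: fdim_mono => //.
  have fs := finite_dim_union (s := [seq cl d setT (f @` E i) | i <- enum 'I_k]) pgd.
  apply: (finite_dim_sub pgd _ (fs _)).
    move=> x [i _ ix]; exists (cl d setT (f @` E i)) => //.
    by apply/mapP; exists i; rewrite ?mem_enum.
  by move=> _ /mapP[i _ ->]; exact: cf_cl.
by move=> _ [x [i _ Eix] <-]; exists i => //; apply: sub_cl; exists x.
Qed.

Lemma emb_strong (Y : set M) E : strongly_embedded d Y (range f) ->
  f @` E = Y -> strongly_embedded h E setT.
Proof.
move=> [_ strong] fEY; split=> // k F cF; rewrite !emb_Delta.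
have cfF : closed_family d (range f) (fun i => f @` F i).
  move=> i; have [cl1 fd] := cF i; split; first exact: emb_closed.
  exact/emb_finite_dim.
apply: le_trans _ (strong _ _ cfF); rewrite le_eqVlt; apply/orP; left; apply/eqP.
congr (Delta d _); apply/funext => i; rewrite -fEY.
apply/seteqP; split=> [_ [x [Fx Ex] <-]|_ [[x Fx <-] [y Ey /finj eyx]]].
  by split; exists x.
by exists x => //; split=> //; rewrite -eyx.
Qed.

End Embeddings.

(** ** Isomorphisms between finite sets *)

Lemma fcut_sub (M : choiceType) (A : {fset M}) E : (fcut A E `<=` A)%fset.
Proof. by apply/fsubsetP => x /fcutP[]. Qed.

(** Inside a star-embedded set, being star-embedded is an internal property. *)
Lemma stable_relative (K : choiceType) (g : {fset K} -> nat) (A X' : {fset K}) :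
  pregeometry g -> stable_span g X' -> (A `<=` X')%fset ->
  stable_span g A <-> forall B C x, (B `<=` A)%fset -> (C `<=` A)%fset ->
    x \in X' -> cl g setT [set` B] x -> cl g setT [set` C] x ->
    cl g setT [set` fcut A (cl g setT [set` B] `&` cl g setT [set` C])] x.
Proof.
move=> pgg st /fsubsetP AX; split.
  move=> stA B C x /fsubsetP BA /fsubsetP CA xX Bx Cx; rewrite fcutE.
  by have -> := stA _ _ (spanned_cl pgg BA) (spanned_cl pgg CA).
move=> rel E F sE sF; have cI := cfI pgg (spanned_cf pgg sE) (spanned_cf pgg sF).
apply/seteqP; split; first by apply: (cl_sub cI.1) => x [].
have sI := st _ _ (spanned_sub pgg AX sE) (spanned_sub pgg AX sF).
apply: (spanned_min sI); first exact: cl_idem.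
move=> x [xX [Ex Fx]]; rewrite -fcutE -sE -sF -!fcutE.
apply: rel => //; rewrite ?fcut_sub// ?fcutE ?sE ?sF//;
  by apply/fsubsetP => y /fcutP[].
Qed.


Section PartialIso.
Variables (M N : choiceType) (d : {fset M} -> nat) (e : {fset N} -> nat).
Implicit Types (A B C X : {fset M}) (E F : set M) (f : M -> N).

Definition piso X f := {in X &, injective f} /\
  forall A, (A `<=` X)%fset -> e (im f A) = d A.

Lemma piso_card X f : piso X f -> #|` im f X| = #|` X|.
Proof. by move=> [finj _]; exact: card_im_in. Qed.

Lemma piso_preim X f (B : {fset N}) : (B `<=` im f X)%fset ->
  exists2 A, (A `<=` X)%fset & B = im f A.
Proof.
move=> /fsubsetP BX; exists [fset x in X | f x \in B]%fset.
  by apply/fsubsetP => x; rewrite !inE => /andP[].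
apply/fsetP => y; apply/idP/imP => [yB|[x + ->]]; last by rewrite !inE => /andP[].
by have /imP[x xX eyx] := BX _ yB; exists x; rewrite // !inE xX -eyx.
Qed.

Hypotheses (pgd : pregeometry d) (pge : pregeometry e).
Local Notation c := (cl d setT).
Local Notation c' := (cl e setT).

Section Transport.
Variables (X : {fset M}) (f : M -> N).
Hypothesis isoX : piso X f.
Let Y := im f X.

Lemma piso_cl A x : (A `<=` X)%fset -> x \in X ->
  c' [set` im f A] (f x) <-> c [set` A] x.
Proof.
move=> AX xX; rewrite !cl_finE// -im_add; have [_ fE] := isoX.
by rewrite !fE// fsubUset fsub1set xX.
Qed.

Lemma fcut_im A E (E' : set N) : (forall x, x \in A -> E' (f x) <-> E x) ->
  fcut (im f A) E' = im f (fcut A E).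
Proof.
move=> EE'; apply/fsetP => y; apply/fcutP/imP.
  move=> [/imP[x xA ->] /(EE' _ xA) Ex]; exists x => //; exact/fcutP.
move=> [x /fcutP[xA Ex] ->]; split; [exact: mem_im|exact/(EE' _ xA)].
Qed.

(** The relative characterization mentions closures in [X] only, which the
    isomorphism preserves. *)
Lemma stable_transport A : stable_span d X -> stable_span e Y ->
  (A `<=` X)%fset -> stable_span d A -> stable_span e (im f A).
Proof.
move=> stX stY AX /(stable_relative pgd stX AX) rel.
apply/(stable_relative pge stY (im_sub f AX)).
move=> B' C' y /piso_preim[B BA ->] /piso_preim[C CA ->] /imP[x xX ->].
have BX := fsubset_trans BA AX; have CX := fsubset_trans CA AX.
rewrite !piso_cl// => Bx Cx.
rewrite (@fcut_im _ (c [set` B] `&` c [set` C])).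
  by apply/piso_cl => //; [exact: fsubset_trans (fcut_sub _ _) AX|exact: rel].
move=> z zA; have zX := fsubsetP AX z zA.
by split=> -[zB zC]; split; move: zB zC; rewrite !piso_cl.
Qed.

(** The closed sets of [X] and of its image correspond by [T], which preserves
    inclusions and dimensions, and so intersections and alternating sums. *)
Lemma rank_transport r : stable_span d X -> stable_span e Y ->
  rank d (closures d X) r = rank e (closures e Y) r.
Proof.
move=> stX stY; have [finj fE] := isoX.
pose T E := c' [set` im f (fcut X E)].
have inv E : spanned d [set` X] E -> fcut Y (T E) = im f (fcut X E).
  move=> sE; apply: fcut_im => x xX; rewrite /T piso_cl ?fcut_sub//.
  by rewrite fcutE sE.
have T_mem E : T E \in closures e Y.
  apply/(closuresP pge); apply: spanned_cl => //.
  by apply/fsubsetP/im_sub/fcut_sub.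
have T_sub E F : spanned d [set` X] E -> spanned d [set` X] F ->
    (T E `<=` T F) <-> (E `<=` F).
  move=> sE sF; split=> [TEF|EF].
    rewrite -[X in X `<=` _]sE -[X in _ `<=` X]sF -!fcutE.
    apply: (cl_min pgd) => x xE.
    have xX : x \in X by have /fcutP[] := xE.
    rewrite -piso_cl ?fcut_sub//; apply: TEF; apply/piso_cl; rewrite ?fcut_sub//.
    exact: sub_cl.
  apply: cl_mono => y /imP[x /fcutP[xX Ex] ->].
  by apply: mem_im; apply/fcutP; split=> //; exact: EF.
have T_inj E F : spanned d [set` X] E -> spanned d [set` X] F -> T E = T F -> E = F.
  by move=> sE sF TEF; apply/seteqP; split; apply/T_sub => //; rewrite TEF.
have T_dim E : spanned d [set` X] E -> fdim e (T E) = fdim d E.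
  move=> sE; rewrite /T fdim_cl//; last exact: finite_dim_fset.
  rewrite fdim_fset// fE ?fcut_sub// -(fdim_fset pgd) fcutE -[in RHS]sE fdim_cl//.
  exact: finite_dimIX.
have T_surj (G : set N) : G \in closures e Y ->
    exists2 E, E \in closures d X & G = T E.
  move=> /(closuresP pge) sG.
  have [A AX eA] := piso_preim (fcut_sub Y G).
  have sA : spanned d [set` X] (c [set` A]) by apply: spanned_cl => //; exact/fsubsetP.
  exists (c [set` A]); first exact/(closuresP pgd).
  rewrite -sG -fcutE eA /T; apply/seteqP; split.
    apply: cl_mono => y /imP[x xA ->]; apply/mem_im/fcutP.
    by split; [exact: (fsubsetP AX)|exact: sub_cl].
  by apply: (cl_min pge) => y /imP[x /fcutP[xX Ax] ->]; exact/piso_cl.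
have frX := frame_closures pgd stX; have frY := frame_closures pge stY.
have sX E : E \in closures d X -> spanned d [set` X] E by move/(closuresP pgd).
have alphaT E : E \in closures d X ->
    alpha e (closures e Y) (T E) = alpha d (closures d X) E.
  move=> EX; rewrite /alpha T_dim//; last exact: sX.
  congr (_ - _)%R; pose bE := below (closures d X) E.
  have bX i : (i < size bE)%N -> nth set0 bE i \in closures d X.
    by move=> ib; have /belowP[] := mem_nth set0 ib.
  rewrite -(@Delta_Dl _ _ pge _ (fun i : 'I_(size bE) => T (nth set0 bE i))).
  - apply/esym/Delta_congr => s s0.
    have memI : \bigcap_(i in [set j : 'I_(size bE) | j \in s]) nth set0 bE i
        \in closures d X.
      by apply: mem_bigcap => //; [exact: frame_meet frX|move=> i; exact: bX].
    rewrite -T_dim; last exact: sX.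
    congr (fdim e _); have memI' := mem_bigcap (frame_meet frY)
      (fun i : 'I_(size bE) => T_mem (nth set0 bE i)) s0.
    have [K KX eK] := T_surj _ memI'; rewrite eK; congr (T _).
    apply/seteqP; split.
      apply/T_sub; rewrite -?eK; [exact: sX|exact: sX|].
      move=> y Ky i si; move: y Ky; apply/T_sub; [exact: sX|exact/sX/bX|].
      by move=> x; apply.
    move=> x Kx i si; move: x Kx; apply/T_sub; [exact: sX|exact/sX/bX|].
    by rewrite -eK => x; apply.
  - by move=> i; exact: (frame_cf pge frY).
  - exact/all_cf_below/(frame_cf pge frY).
  - move=> i; have /belowP[FX FE neq] := mem_nth set0 (ltn_ord i).
    exists (T (nth set0 bE i)) => //; apply/belowP; split=> //.
      by apply/T_sub => //; exact: sX.
    by move=> eT; apply: neq; exact: T_inj (sX _ FX) (sX _ EX) eT.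
  - move=> _ /belowP[/T_surj[F FX ->] FE neq].
    have Fb : F \in below (closures d X) E.
      apply/belowP; split=> //; first exact/(T_sub F E (sX _ FX) (sX _ EX)).
      by move=> eF; apply: neq; rewrite eF.
    have /(nthP set0)[i ib eF] := Fb; exists (Ordinal ib).
    by rewrite /= -/bE eF.
rewrite /rank [RHS](perm_big [seq T E | E <- undup (closures d X)])/=; last first.
  apply: uniq_perm; first exact: undup_uniq.
    rewrite map_inj_in_uniq ?undup_uniq// => E F; rewrite !mem_undup => EX FX.
    by apply: T_inj; exact: sX.
  move=> G; rewrite mem_undup; apply/idP/mapP => [/T_surj[E EX ->]|[E _ ->]//].
  by exists E; rewrite ?mem_undup.
rewrite big_map big_seq_cond [RHS]big_seq_cond; apply: congr_big => //.
  by move=> E; rewrite mem_undup; case: (boolP (E \in _)) => //= /sX/T_dim->.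
by move=> E; rewrite mem_undup => /andP[/alphaT->].
Qed.

End Transport.

(** The point [x0] serves as a default value outside of the image. *)
Lemma piso_inv X f (x0 : M) : piso X f ->
  exists2 g : N -> M, {in X, cancel f g} & {in im f X, cancel g f}.
Proof.
move=> [finj _]; pose P y x := x \in X /\ f x = y.
exists (fun y => xget x0 (P y)) => [x xX|_ /imP[x xX ->]].
  by case: xgetP => [z _ [zX /finj->//]|/(_ x)[]].
by case: xgetP => [z _ []//|/(_ x)[]].
Qed.

End PartialIso.

Lemma piso_sym (M N : choiceType) (d : {fset M} -> nat) (e : {fset N} -> nat)
    X f (g : N -> M) : piso d e X f -> {in X, cancel f g} ->
  piso e d (im f X) g /\ im g (im f X) = X.
Proof.
move=> [finj fE] fK; split; last by rewrite im_comp im_id.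
split=> [_ _ /imP[x xX ->] /imP[y yX ->]|B /piso_preim[A AX ->]].
  by rewrite !fK// => ->.
by rewrite fE// im_comp im_id// => x /(fsubsetP AX)/fK.
Qed.


(** ** Extending isomorphisms by the axioms *)

Lemma restr_emb (M : choiceType) (d : {fset M} -> nat) (X : {fset M}) :
  pg_embedding (restr d (F := X)) d (fun x : X => val x).
Proof. by split; first exact: val_inj. Qed.

Lemma range_val (M : choiceType) (X : {fset M}) :
  range (fun x : X => val x) = [set` X].
Proof.
apply/seteqP; split=> [_ [x _ <-] /=|x xX]; first exact: valP.
by exists [` xX]%fset.
Qed.

Lemma restr_flat (M : choiceType) (d : {fset M} -> nat) (X : {fset M}) :
  flat_pregeometry d -> stable_span d X -> flat_pregeometry (restr d (F := X)).
Proof.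
move=> [pgd fld] st; split; first exact: emb_pregeometry (restr_emb d X) pgd.
exact: (emb_flat (restr_emb d X) pgd fld st (range_val X)).
Qed.

Section Extension.
Variables (tau : nat -> nat) (M N : choiceType).
Variables (d : {fset M} -> nat) (e : {fset N} -> nat).
Hypotheses (fld : flat_pregeometry d) (axe : extension_axiom tau e).

(** The extension axiom of [e], applied to [X2] as an extension of the isomorphic
    copy [im g Y] of [Y]. *)
Lemma extend_iso (Y : {fset N}) (g : N -> M) (X2 : {fset M}) n (y0 : N) :
  piso e d Y g -> (im g Y `<=` X2)%fset -> stable_span d X2 ->
  strongly_embedded d [set` im g Y] [set` X2] ->
  n_embedded e (tau (#|` X2| + n)) [set` Y] ->
  exists f : M -> N, [/\ piso d e X2 f, {in Y, cancel g f} &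
    n_embedded e n [set` im f X2]].
Proof.
move=> [ginj gE] /fsubsetP gYX st strong nY.
have iP (y : Y) : g (val y) \in X2 by apply/gYX/mem_im/valP.
pose i (y : Y) : X2 := [` iP y]%fset.
have emb_i : pg_embedding (restr e (F := Y)) (restr d (F := X2)) i.
  split=> [x y [] /ginj|A].
    by move=> /(_ (valP x) (valP y))/val_inj.
  rewrite /restr -!/(im _ _) im_comp.
  rewrite -gE; last by apply/fsubsetP => _ /imP[y _ ->]; exact: valP.
  by rewrite im_comp.
have strong_i : strongly_embedded (restr d (F := X2)) (range i) setT.
  apply: (emb_strong (restr_emb d X2) (Y := [set` im g Y])).
    by rewrite range_val.
  rewrite set_im; apply/seteqP; split=> [_ [_ [y _ <-] <-]|_ [y yY <-]] /=.
    by exists (val y) => //; exact: valP.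
  by exists (i [` yY]%fset) => //; exists [` yY]%fset.
have nY' : n_embedded e (tau (#|X2 : finType| + n)) [set` Y] by rewrite -cardfE.
have [f [[finj fE] fi nf]] := axe nY'.1 (restr_flat fld st) emb_i strong_i nY'.
pose F x := if insub x is Some z then f z else y0.
have FE (z : X2) : F (val z) = f z by rewrite /F valK.
have lift A : (A `<=` X2)%fset -> exists2 A' : {fset X2}, A = im val A' &
    im F A = im f A'.
  move=> /fsubsetP AX; exists [fset z : X2 | val z \in A]%fset.
    apply/fsetP => x; apply/idP/imP => [xA|[z + ->]]; last by rewrite !inE.
    by exists [` AX _ xA]%fset; rewrite ?inE.
  apply/fsetP => y; apply/imP/imP => [[x xA ->]|[z + ->]].
    by exists [` AX _ xA]%fset; rewrite ?inE// -FE.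
  by rewrite !inE => zA; exists (val z); rewrite ?FE.
have FX : [set` im F X2] = range f.
  rewrite set_im; apply/seteqP; split=> [_ [x xX <-]|_ [z _ <-]].
    by exists [` xX]%fset; rewrite // -FE.
  by exists (val z); [exact: valP|exact: FE].
exists F; split; last by rewrite FX.
- split=> [x y xX yX|A AX].
    rewrite -[x]/(val [` xX]%fset) -[y]/(val [` yX]%fset) !FE.
    by move=> /finj->.
  by have [A' -> ->] := lift A AX; rewrite -[LHS]/(e [fset f x | x in A']%fset) fE.
- by move=> y yY; rewrite -[g y]/(val (i [` yY]%fset)) FE fi.
Qed.

End Extension.

(** ** Copying star-embedded sets along the predicates *)

(** The same equalities, and the same predicates for pregeometries of size at most
    [B]; subtuples [t] are needed because [a] may have repetitions. *)
Definition agree (M N : structure L_EX) n (B : nat) (a : n.-tuple M)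
    (b : n.-tuple N) :=
  (forall i j, tnth a i = tnth a j <-> tnth b i = tnth b j) /\
  forall (s : ex_symb) (t : (ex_nx s).-tuple 'I_n), ex_nx s + ex_ny s <= B ->
    interp M (inr s) [tuple of [seq tnth a i | i <- t]] <->
    interp N (inr s) [tuple of [seq tnth b i | i <- t]].

Lemma agree_sym (M N : structure L_EX) n B (a : n.-tuple M) (b : n.-tuple N) :
  agree B a b -> agree B b a.
Proof. by move=> [eqab rab]; split=> *; apply: iff_sym; auto. Qed.

Lemma agree_leq (M N : structure L_EX) n B B' (a : n.-tuple M) (b : n.-tuple N) :
  B <= B' -> agree B' a b -> agree B a b.
Proof.
by move=> BB [eqab rab]; split=> // s t sB; apply: rab; exact: leq_trans BB.
Qed.

(** [X] is enumerated so that the distinct entries of [a] come first; the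
    predicate of its isomorphism type then holds of them, hence of the
    corresponding entries of [b]. *)
Lemma copy_star (M N : structure L_EX) d e n B (a : n.-tuple M) (b : n.-tuple N)
    (X : {fset M}) (y0 : N) :
  @EX_interpretation M d -> @EX_interpretation N e ->
  flat_pregeometry d -> pregeometry e -> stable_span d X ->
  (forall i, tnth a i \in X) -> #|` X| <= B -> agree B a b ->
  exists f : M -> N, [/\ piso d e X f, stable_span e (im f X) &
    forall i, f (tnth a i) = tnth b i].
Proof.
move=> [_ intM] [_ intN] [pgd fld] pge st aX XB [eqab rab].
pose s := undup a; pose r := [seq x <- X | x \notin s].
have us : uniq (s ++ r).
  rewrite cat_uniq undup_uniq filter_uniq ?fset_uniq//= andbT.
  by apply/hasPn => x; rewrite mem_filter => /andP[].
have memT x : (x \in s ++ r) = (x \in X).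
  rewrite mem_cat mem_filter; have [xs|//] := boolP (x \in s).
  by move: xs; rewrite mem_undup => /tnthP[i ->]; rewrite aX.
pose T := [tuple of in_tuple s ++ in_tuple r].
have Tinj : injective (tnth T) by apply/tuple_uniqP.
pose h A := d (im (tnth T) A).
have embT : pg_embedding h d (tnth T) by split.
have rangeT : range (tnth T) = [set` X].
  apply/seteqP; split=> [_ [i _ <-] /=|x /=]; rewrite -memT; first exact: mem_tnth.
  by move=> /(@tnthP _ _ T)[i ->]; exists i.
have flh : flat_pregeometry h.
  by split; [exact: emb_pregeometry embT pgd|exact: emb_flat embT _ pgd fld st rangeT].
have /choice[ti tiP] : forall j : 'I_(size s), exists i, tnth a i = tnth (in_tuple s) j.
  move=> j; have : tnth (in_tuple s) j \in a by rewrite -mem_undup mem_tnth.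
  by move=> /tnthP[i ->]; exists i.
pose t := [tuple ti j | j < size s].
have at_s : [tuple of [seq tnth a i | i <- t]] = in_tuple s.
  by apply: eq_from_tnth => j; rewrite tnth_map tnth_mktuple tiP.
have := rab (ExSymb flh) t; rewrite /= -size_cat.
have -> : size (s ++ r) = #|` X|.
  by apply/perm_size/uniq_perm; rewrite ?fset_uniq.
move=> /(_ XB)[+ _]; rewrite at_s => /(_ _)/wrap[].
  apply/(intM (ExSymb flh)); exists (in_tuple r); split=> //.
  rewrite (_ : [set x | x \in T] = [set` X]); first exact/star_embeddedP.
  by apply/seteqP; split=> x /=; rewrite memT.
move=> /(intN (ExSymb flh))[u [/= [T'inj T'E] starT']].
set T' := cat_tuple _ u in T'inj T'E starT'.
pose f x := nth y0 T' (index x T).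
have fT i : f (tnth T i) = tnth T' i.
  by rewrite /f (tnth_nth (tnth T i)) index_uniq ?size_tuple// -tnth_nth.
have imT A : (A `<=` X)%fset -> exists2 A0, A = im (tnth T) A0 & im f A = im (tnth T') A0.
  move=> /fsubsetP AX; have [|A0 _ ->] := @emb_preim _ _ (tnth T) setT A.
    by rewrite rangeT => x /AX.
  by exists A0; rewrite // im_comp; apply: im_ext => i _ /=.
exists f; split.
- split=> [x y|A /imT[A0 -> ->]]; last exact: T'E.
  by rewrite -!memT => /(@tnthP _ _ T)[i ->] /(@tnthP _ _ T)[j ->]; rewrite !fT => /T'inj->.
- apply/(star_embeddedP pge); rewrite (_ : [set` im f X] = [set x | x \in T'])//.
  have [A0 eX ->] := imT X (fsubset_refl X).
  apply/seteqP; split=> y /=; first by move=> /imP[i _ ->]; exact: mem_tnth.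
  move=> /tnthP[i ->]; apply: mem_im.
  have : tnth T i \in X by rewrite -memT mem_tnth.
  by rewrite eX => /imP[j jA0 /Tinj->].
move=> i; have : tnth a i \in in_tuple s by rewrite mem_undup mem_tnth.
move=> /tnthP[j aj].
have -> : tnth a i = tnth T (lshift _ j) by rewrite tnth_lshift.
rewrite fT tnth_lshift tnth_map tnth_mktuple.
by apply/eqab; rewrite tiP aj.
Qed.

(** * Choosing embedded supersets in two models at once *)

Lemma n_embedded_leq (M : choiceType) (d : {fset M} -> nat) m m' X :
  m <= m' -> n_embedded d m' X -> n_embedded d m X.
Proof.
move=> mm [st strong]; split=> // Y XY stY Ym; apply: strong => //.
by apply: card_le_trans Ym _; rewrite card_le_II.
Qed.

(** The states of the descent: isomorphic star-embedded supersets of two tuples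
    in two models.  The points [ps_x0] and [ps_y0] make the models inhabited. *)
Record pair_state n := PairState {
  ps_M : structure L_EX; ps_N : structure L_EX;
  ps_d : {fset ps_M} -> nat; ps_e : {fset ps_N} -> nat;
  ps_intM : EX_interpretation ps_d; ps_intN : EX_interpretation ps_e;
  ps_fld : flat_pregeometry ps_d; ps_fle : flat_pregeometry ps_e;
  ps_x0 : ps_M; ps_y0 : ps_N;
  ps_a : n.-tuple ps_M; ps_b : n.-tuple ps_N;
  ps_X : {fset ps_M}; ps_f : ps_M -> ps_N;
  ps_aX : forall i, tnth ps_a i \in ps_X;
  ps_iso : piso ps_d ps_e ps_X ps_f;
  ps_fa : forall i, ps_f (tnth ps_a i) = tnth ps_b i;
  ps_stM : stable_span ps_d ps_X;
  ps_stN : stable_span ps_e (im ps_f ps_X);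
  ps_dim : ps_d ps_X <= n }.

Definition selected (g : nat -> nat) (M N : structure L_EX) d e n
    (a : n.-tuple M) (b : n.-tuple N) (K : nat) :=
  exists (X : {fset M}) (f : M -> N), [/\ (forall i, tnth a i \in X) /\ #|` X| <= K,
    piso d e X f, forall i, f (tnth a i) = tnth b i,
    n_embedded d (g #|` X|) [set` X] & n_embedded e (g #|` X|) [set` im f X]].

(** Start from any star-embedded superset and its copy.  As long as one of the two
    is not embedded as required, enlarge it so as to lower its rank and copy the
    result to the other model; the copies have the same rank. *)
Lemma selection g n : exists B, forall (M N : structure L_EX) d e
    (x0 : M) (y0 : N) (a : n.-tuple M) (b : n.-tuple N),
  @EX_interpretation M d -> @EX_interpretation N e ->
  flat_pregeometry d -> flat_pregeometry e ->
  agree B a b -> selected g d e a b B.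
Proof.
have [B0 HB0] := star_superset n.
have /choice[b0 Hb0] := fun j => star_descent (g j) n j.
pose c j := maxn j (b0 j).
have [||||B HB] := @bounded_descent (pair_state n) (fun x => #|` ps_X x|)
  (fun x => rank (@ps_d _ x) (closures (@ps_d _ x) (ps_X x))) n c
  (fun j => 2 ^ j * (2 ^ (2 ^ j) * j))
  (fun K x => agree K (ps_a x) (ps_b x))
  (fun K x => selected g (@ps_d _ x) (@ps_e _ x) (ps_a x) (ps_b x) K) _ _ _ _ B0.
- case=> M N d e _ _ [pgd fld] _ _ _ a b X f _ _ _ st _ _ r /=.
  rewrite -(size_closures d X); exact: (rank_le pgd fld r (frame_closures pgd st)).
- by move=> K K' x; exact: agree_leq.
- move=> K K' x KK [X [f [[aX XK] iso fa nd ne]]]; exists X, f; split=> //.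
  by split=> //; exact: leq_trans KK.
- case=> M N d e intM intN fld fle x0 y0 a b X f aX iso fa stM stN dX /= ab.
  have [pgd _] := fld; have [pge _] := fle.
  have bc : b0 #|` X| <= c #|` X| by rewrite leq_max leqnn orbT.
  have [nd|nd] := pselect (n_embedded d (g #|` X|) [set` X]); last first.
    have [X' [XX' stX' dX' X'B ltX']] := Hb0 _ _ _ _ fld stM dX (leqnn _) nd.
    have aX' i : tnth a i \in X' by exact/(fsubsetP XX').
    have X'c := leq_trans X'B bc.
    have [f' [iso' st' fa']] := copy_star y0 intM intN fld pge stX' aX' X'c ab.
    have dX'n : d X' <= n by rewrite dX'.
    by right; exists (PairState intM intN fld fle x0 y0 aX' iso' fa' stX' st' dX'n).
  have [ne|ne] := pselect (n_embedded e (g #|` X|) [set` im f X]).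
    by left; exists X, f; split=> //; split=> //; rewrite leq_max leqnn.
  have cardY := piso_card iso; rewrite -cardY in bc ne ab *.
  have dY : e (im f X) <= n by rewrite iso.2.
  have [Y' [YY' stY' dY' Y'B ltY']] := Hb0 _ _ _ _ fle stN dY (leqnn _) ne.
  have bY' i : tnth b i \in Y' by rewrite -fa; exact/(fsubsetP YY')/mem_im.
  have Y'c := leq_trans Y'B bc.
  have [h [isoh sth hb]] :=
    copy_star x0 intN intM fle pgd stY' bY' Y'c (agree_sym ab).
  have [f' hK _] := piso_inv y0 isoh.
  have [iso' imf'] := piso_sym isoh hK.
  have aX' i : tnth a i \in im h Y' by rewrite -hb mem_im.
  have fa' i : f' (tnth a i) = tnth b i by rewrite -hb hK.
  have stf' : stable_span e (im f' (im h Y')) by rewrite imf'.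
  have dX' : d (im h Y') <= n by rewrite isoh.2// dY'.
  right; exists (PairState intM intN fld fle x0 y0 aX' iso' fa' sth stf' dX').
  split=> //=; first by rewrite (piso_card isoh).
  apply: (lt_lex_eq _ _ ltY') => r _.
    by rewrite (rank_transport pge pgd isoh r stY' sth).
  by rewrite (rank_transport pgd pge iso r stM stN).
exists (maxn B0 B) => M N d e x0 y0 a b intM intN fld fle ab.
have [pgd _] := fld; have [pge _] := fle.
have [|X [AX st dX XB]] := HB0 M d [fset x in (a : seq M)]%fset fld.
  by rewrite card_fseq (leq_trans (size_undup _))// size_tuple.
have aX i : tnth a i \in X.
  by apply: (fsubsetP AX); rewrite in_fset /= mem_tnth.
have XB' : #|` X| <= maxn B0 B by rewrite leq_max XB.
have [f [iso stf fa]] := copy_star y0 intM intN fld pge st aX XB' ab.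
have dXn : d X <= n.
  rewrite dX (leq_trans (dim_card pgd _))//.
  by rewrite card_fseq (leq_trans (size_undup _))// size_tuple.
have BB : B <= maxn B0 B by rewrite leq_max leqnn orbT.
have [|X' [f' [[aX' X'B] ? ? ? ?]]] :=
    HB (PairState intM intN fld fle x0 y0 aX iso fa st stf dXn) XB.
  exact: agree_leq ab.
by exists X', f'; split=> //; split=> //; exact: leq_trans BB.
Qed.

Definition T_model tau (N : structure L_EX) (d : {fset N} -> nat) :=
  [/\ EX_interpretation d, flat_pregeometry d, ~ finite_dim d setT &
    extension_axiom tau d].
Arguments T_model : clear implicits.

Section Models.
Variable tau : nat -> nat.

Lemma T_model_point N d : T_model tau N d -> exists x : N, True.
Proof.
move=> [_ [pgd _] inf _]; apply: contrapT => nex; apply: inf.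
apply: (finite_dim_sub pgd _ (finite_dim_fset pgd fset0)) => x _.
by case: nex; exists x.
Qed.

Lemma agree_refl (N : structure L_EX) n B (a : n.-tuple N) : agree B a a.
Proof. by split. Qed.

(** [selection] for twice the same model. *)
Lemma n_embedded_superset g k : exists B,
  forall (N : structure L_EX) d (A : {fset N}), T_model tau N d ->
  #|` A| <= k -> exists X : {fset N},
    [/\ (A `<=` X)%fset, #|` X| <= B & n_embedded d (g #|` X|) [set` X]].
Proof.
have /choice[Bf HB] := selection g.
exists (\max_(j < k.+1) Bf j) => N d A modN Ak.
have [x0 _] := T_model_point modN; have [intN fl _ _] := modN.
have [X [f [[aX XB] _ _ nd _]]] :=
  HB #|` A| N N d d x0 x0 (in_tuple A) (in_tuple A) intN intN fl fl (agree_refl _ _).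
exists X; split=> //.
  by apply/fsubsetP => x xA; have /tnthP[i ->] : x \in in_tuple A by [].
rewrite (leq_trans XB)//; have Ak' : #|` A| < k.+1 by [].
exact: (@leq_bigmax _ (fun j : 'I_k.+1 => Bf j) (Ordinal Ak')).
Qed.

(** * The back-and-forth argument *)

(** Enlarge the domain to an embedded set in [M]; over [X] it is a strong
    extension, so that the extension axiom of [N] provides its copy. *)
Lemma extend_embedded g k s : exists m,
  forall (M N : structure L_EX) d e (X : {fset M}) (f : M -> N)
    (A : {fset M}), T_model tau M d -> T_model tau N e -> #|` X| <= s -> #|` A| <= k ->
  piso d e X f -> n_embedded d m [set` X] -> n_embedded e m [set` im f X] ->
  exists (X2 : {fset M}) (F : M -> N), [/\ (X `<=` X2)%fset /\ (A `<=` X2)%fset,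
    piso d e X2 F, {in X, F =1 f}, n_embedded d (g #|` X2|) [set` X2] &
    n_embedded e (g #|` X2|) [set` im F X2]].
Proof.
have [B HB] := n_embedded_superset g (s + k).
exists (maxn B (\max_(j < B.+1) tau (j + g j))) => M N d e X f A modM modN Xs Ak iso nd ne.
have [_ fld _ _] := modM; have [_ fle _ axe] := modN.
have [pgd _] := fld; have [pge _] := fle.
have [x0 _] := T_model_point modM; have [y0 _] := T_model_point modN.
have [|X2 [XAX2 X2B nX2]] := HB M d (X `|` A)%fset modM.
  by rewrite cardfsU (leq_trans (leq_subr _ _))// leq_add.
move: XAX2; rewrite fsubUset => /andP[XX2 AX2].
have st2 : stable_span d X2 by apply/(star_embeddedP pgd); case: nX2.
have [h fK hK] := piso_inv x0 iso; have [isoh imh] := piso_sym iso fK.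
have strong : strongly_embedded d [set` im h (im f X)] [set` X2].
  rewrite imh; apply: nd.2; first by move=> x /(fsubsetP XX2).
    by case: nX2.
  apply: (@card_le_trans _ _ _ [set` X2]); first by apply: subset_card_le => x [].
  have cX2 : ([set` X2] #= `I_#|` X2|)%card by exact/card_eq_fsetP.
  by rewrite (card_le_eql cX2) card_le_II leq_max X2B.
have nY : n_embedded e (tau (#|` X2| + g #|` X2|)) [set` im f X].
  apply: n_embedded_leq ne; rewrite leq_max; apply/orP; right.
  have X2B' : #|` X2| < B.+1 by [].
  exact: (@leq_bigmax _ (fun j : 'I_B.+1 => tau (j + g j)) (Ordinal X2B')).
have hX2 : (im h (im f X) `<=` X2)%fset by rewrite imh.
have [F [isoF hF nF]] := extend_iso fld axe y0 isoh hX2 st2 strong nY.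
exists X2, F; split=> // x xX.
by rewrite -{1}(fK _ xX) hF// mem_im.
Qed.

End Models.

(** ** Formulas *)

Lemma map_tupleE n (M N : Type) (f : M -> N) (a : n.-tuple M) m (t : m.-tuple 'I_n) :
  [seq tnth [tuple of map f a] i | i <- t] = [seq f x | x <- [seq tnth a i | i <- t]].
Proof. by rewrite -map_comp; apply: eq_map => i; rewrite /= tnth_map. Qed.

Section BackAndForth.
Variable tau : nat -> nat.

Definition preserved n (f : formula L_EX n) (mu : nat -> nat) :=
  forall (M N : structure L_EX) d e (X : {fset M}) (F : M -> N) (a : n.-tuple M),
    T_model tau M d -> T_model tau N e -> piso d e X F ->
    n_embedded d (mu #|` X|) [set` X] -> n_embedded e (mu #|` X|) [set` im F X] ->
    (forall i, tnth a i \in X) -> sat f a -> sat f [tuple of map F a].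

Lemma preserved_iff n (f : formula L_EX n) mu : preserved f mu ->
  forall (M N : structure L_EX) d e (X : {fset M}) (F : M -> N) (a : n.-tuple M),
    T_model tau M d -> T_model tau N e -> piso d e X F ->
    n_embedded d (mu #|` X|) [set` X] -> n_embedded e (mu #|` X|) [set` im F X] ->
    (forall i, tnth a i \in X) -> sat f a <-> sat f [tuple of map F a].
Proof.
move=> pf M N d e X F a modM modN iso nd ne aX; split; first exact: pf nd ne aX.
have [x0 _] := T_model_point modM; have [G FK _] := piso_inv x0 iso.
have [isoG imG] := piso_sym iso FK.
have := pf _ _ _ _ _ _ [tuple of map F a] modN modM isoG.
rewrite (piso_card iso) imG => /(_ ne nd) + sFa => /(_ _ sFa)/wrap[].
  by move=> i; rewrite tnth_map mem_im.
rewrite (_ : [tuple of map G _] = a)//; apply: eq_from_tnth => i.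
by rewrite !tnth_map FK.
Qed.

(** Independence is read off from the isomorphism.  For the predicate of a
    pregeometry, the isomorphism is extended to the witnesses; star-embeddedness
    of the tuple can be tested inside the extended domain. *)
Lemma preserved_rel n r (t : (arity r).-tuple 'I_n) :
  exists mu, preserved (@Rel L_EX n r t) mu.
Proof.
case: r t => [k|s] t.
  exists (fun=> 0) => M N d e X F a [intM _ _ _] [intN _ _ _] iso _ _ aX.
  case: intM intN => [intM _] [intN _].
  move=> /(intM k _) dk; apply/(intN k _); rewrite -[RHS]dk.
  rewrite -iso.2; last first.
    by apply/fsubsetP => x; rewrite in_fset => /mapP[i _ ->].
  congr (e _); apply/fsetP => y; rewrite in_fset /= map_tupleE.
  by apply/mapP/imP => -[x xt ->]; exists x; rewrite // ?in_fset// in xt *.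
have /choice[mu Hmu] := extend_embedded tau (fun=> 0) (ex_ny s).
exists mu => M N d e X F a modM modN iso nd ne aX /=.
have [[_ intM] [pgd _] _ _] := modM; have [[_ intN] [pge _] _ _] := modN.
move=> /intM[u [[Tinj TE] stT]].
have su : #|` [fset x in (u : seq M)]%fset| <= ex_ny s.
  by rewrite card_fseq (leq_trans (size_undup _))// size_tuple.
have [X2 [G [[XX2 uX2] isoG GF n2 n2']]] :=
  Hmu #|` X| M N d e X F _ modM modN (leqnn _) su iso nd ne.
set T := cat_tuple _ u in Tinj TE stT.
have TX2 x : x \in T -> x \in X2.
  rewrite mem_cat => /orP[/mapP[i _ ->]|xu]; first exact/(fsubsetP XX2).
  by apply: (fsubsetP uX2); rewrite in_fset.
have imTX A : (im (tnth T) A `<=` X2)%fset.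
  by apply/fsubsetP => _ /imP[i _ ->]; apply/TX2/mem_tnth.
have st2 : stable_span d X2 by apply/(star_embeddedP pgd); case: n2.
have st2' : stable_span e (im G X2) by apply/(star_embeddedP pge); case: n2'.
apply/intN; exists [tuple of map G u].
set T' := cat_tuple _ _.
have T'E i : tnth T' i = G (tnth T i).
  have -> : T' = [tuple of map G T].
    apply: val_inj; rewrite /= map_cat map_tupleE; congr (_ ++ _).
    by apply/eq_in_map => _ /mapP[i' _ ->]; rewrite GF.
  by rewrite tnth_map.
split.
- split=> [i j|A].
    rewrite !T'E => eG; apply: Tinj; apply: isoG.1 eG; exact/TX2/mem_tnth.
  rewrite -TE -[RHS](isoG.2 _ (imTX A)) im_comp; congr (e _).
  by apply: im_ext => i _; exact: T'E.
have setT : [set` im (tnth T) [fset i in 'I_(ex_nx s + ex_ny s)]%fset] =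
    [set x | x \in T].
  apply/seteqP; split=> x /=; first by move=> /imP[i _ ->]; exact: mem_tnth.
  by move=> /tnthP[i ->]; apply: mem_im; rewrite in_fset.
rewrite -setT in stT; move: stT => /(star_embeddedP pgd) stT.
have := stable_transport pgd pge isoG st2 st2' (imTX _) stT.
rewrite im_comp => /(star_embeddedP pge); congr (star_embedded e _ _).
apply/seteqP; split=> y /=.
  by move=> /imP[i _ ->] /=; rewrite -T'E mem_tnth.
by move=> /tnthP[i ->]; rewrite T'E; apply/imP; exists i; rewrite // in_fset.
Qed.

Lemma preserved_mono n (f : formula L_EX n) mu mu' :
  (forall k, mu k <= mu' k) -> preserved f mu -> preserved f mu'.
Proof.
move=> le pf M N d e X F a modM modN iso nd ne.
exact: pf modM modN iso (n_embedded_leq (le _) nd) (n_embedded_leq (le _) ne).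
Qed.

(** A quantifier is dealt with by extending the isomorphism to the new element,
    which asks for better embedded sets. *)
Lemma back_and_forth n (f : formula L_EX n) : exists mu, preserved f mu.
Proof.
elim: n / f => [n i j|n r t|n|n f [mu pf] g [nu pg]|n f [mu pf]].
- exists (fun=> 0) => M N d e X F a _ _ _ _ _ _ /= aij.
  by rewrite !tnth_map aij.
- exact: preserved_rel.
- by exists (fun=> 0).
- pose m k := maxn (mu k) (nu k).
  have {}pf : preserved f m by apply: preserved_mono pf => k; rewrite leq_maxl.
  have {}pg : preserved g m by apply: preserved_mono pg => k; rewrite leq_maxr.
  exists m => M N d e X F a modM modN iso nd ne aX /= fg.
  move=> /(preserved_iff pf modM modN iso nd ne aX)/fg.
  exact: pg modM modN iso nd ne aX.
have /choice[nu Hnu] := extend_embedded tau mu 1.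
exists nu => M N d e X F a modM modN iso nd ne aX /= fa y.
have [x0 _] := T_model_point modM; have [G FK _] := piso_inv x0 iso.
have [isoG imG] := piso_sym iso FK.
have sY : #|` im F X| <= #|` X| by rewrite (piso_card iso).
have sy : #|` [fset y]%fset| <= 1 by rewrite cardfs1.
have nd' : n_embedded d (nu #|` X|) [set` im G (im F X)] by rewrite imG.
have [X2 [H [[YX2 yX2] isoH HG n2 n2']]] :=
  Hnu #|` X| N M e d (im F X) G [fset y]%fset modN modM sY sy isoG ne nd'.
apply/(preserved_iff pf modN modM isoH n2 n2').
  move=> i; have /predU1P[->|] : tnth [tuple of y :: map F a] i \in y :: map F a.
    exact: mem_tnth.
    by apply: (fsubsetP yX2); rewrite inE.
  move=> /mapP[x /tnthP[j ->] ->]; exact/(fsubsetP YX2)/mem_im.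
rewrite (_ : [tuple of map H _] = [tuple of H y :: a])//.
apply: val_inj => /=; congr (_ :: _); rewrite -map_comp.
apply: map_id_in => x /tnthP[i ->] /=.
by rewrite HG ?FK// mem_im.
Qed.

End BackAndForth.

(** A property that is determined by the truth values of [k] quantifier-free
    formulas is quantifier-free: split into cases along the first formula. *)
Lemma qf_of_finite n k (G : 'I_k -> formula L_EX n)
    (C P : forall N : structure L_EX, n.-tuple N -> Prop) :
  (forall i, quantifier_free (G i)) ->
  (forall (M N : structure L_EX) (a : n.-tuple M) (b : n.-tuple N), C M a -> C N b ->
    (forall i, sat (G i) a <-> sat (G i) b) -> P M a -> P N b) ->
  exists2 g : formula L_EX n, quantifier_free g &
    forall (N : structure L_EX) (a : n.-tuple N), C N a -> P N a <-> sat g a.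
Proof.
elim: k G C => [|k IH] G C qfG CP.
  have [[M [a [CMa PMa]]]|nP] :=
      pselect (exists (M : structure L_EX) (a : n.-tuple M), C M a /\ P M a).
    exists (Imp (Bot L_EX n) (Bot L_EX n)) => // N b CNb; split=> [_ /=|_] //.
    by apply: CP CMa CNb _ PMa => -[].
  by exists (Bot L_EX n) => // N a CNa; split=> // PNa; case: nP; exists N, a.
have step (Q : Prop -> Prop) : (Q = id \/ Q = not) ->
    exists2 g : formula L_EX n, quantifier_free g &
      forall (N : structure L_EX) (a : n.-tuple N),
        C N a /\ Q (sat (G ord0) a) -> P N a <-> sat g a.
  move=> QE; apply: (IH (fun i => G (lift ord0 i))) => [i|]; first exact: qfG.
  move=> M N a b [CMa QMa] [CNb QNb] GE; apply: CP => // i.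
  have [->|] := eqVneq i ord0; first by case: QE QMa QNb => -> /=; tauto.
  by case: (unliftP ord0 i) => [j ->|->]; rewrite ?eqxx.
have [g1 qf1 g1P] := step id (or_introl erefl).
have [g2 qf2 g2P] := step not (or_intror erefl).
pose nG := Imp (G ord0) (Bot L_EX n); pose nn h := Imp h (Bot L_EX n).
exists (nn (Imp (Imp (G ord0) g1) (nn (Imp nG g2)))).
  by rewrite /= !qfG qf1 qf2.
move=> N a CNa /=.
have [G0|G0] := pselect (sat (G ord0) a).
  by have := g1P N a (conj CNa G0); have [] := pselect (sat g1 a); tauto.
by have := g2P N a (conj CNa G0); have [] := pselect (sat g2 a); tauto.
Qed.

(** There are finitely many pregeometries on sets of size at most [B], as their
    values are bounded by [B]. *)
Lemma finite_agree n B : exists k (G : 'I_k -> formula L_EX n),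
  (forall i, quantifier_free (G i)) /\
  forall (M N : structure L_EX) (a : n.-tuple M) (b : n.-tuple N),
    (forall i, sat (G i) a <-> sat (G i) b) -> agree B a b.
Proof.
pose I := {p : 'I_B.+1 * 'I_B.+1 & ({ffun {fset 'I_(p.1 + p.2)} -> 'I_B.+1} *
  p.1.-tuple 'I_n)%type}.
pose J := ('I_n * 'I_n + I)%type.
pose atom (x : J) : formula L_EX n := match x with
  | inl p => Eq L_EX p.1 p.2
  | inr p => match pselect (flat_pregeometry (fun A => nat_of_ord ((tagged p).1 A))) with
    | left fl => @Rel L_EX n (inr (ExSymb fl)) (tagged p).2
    | right _ => Bot L_EX n
    end
  end.
exists #|{: J}|, (fun i => atom (enum_val i)); split.
  move=> i; case: (enum_val i) => //= p.
  by case: pselect.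
move=> M N a b ab; have {}ab x : sat (atom x) a <-> sat (atom x) b.
  by have := ab (enum_rank x); rewrite enum_rankK.
split=> [i j|]; first exact: (ab (inl (i, j))).
case=> nx ny h fl t /= sB.
have nxB : nx < B.+1 by rewrite ltnS (leq_trans _ sB)// leq_addr.
have nyB : ny < B.+1 by rewrite ltnS (leq_trans _ sB)// leq_addl.
pose p : 'I_B.+1 * 'I_B.+1 := (Ordinal nxB, Ordinal nyB).
pose hf : {ffun {fset 'I_(p.1 + p.2)} -> 'I_B.+1} := [ffun A => inord (h A)].
have hE : h = fun A => nat_of_ord (hf A).
  apply/funext => A; rewrite ffunE inordK// ltnS (leq_trans _ sB)//.
  apply: leq_trans (dim_card fl.1 A) _.
  by rewrite cardfE -[leqRHS]card_ord; exact: leq_card val_inj.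
have transfer h0 (fl0 : flat_pregeometry h0) : h0 = h ->
    (sat (@Rel L_EX n (inr (ExSymb fl0)) t) a <->
     sat (@Rel L_EX n (inr (ExSymb fl0)) t) b) ->
    (sat (@Rel L_EX n (inr (ExSymb fl)) t) a <->
     sat (@Rel L_EX n (inr (ExSymb fl)) t) b).
  by move=> eh; move: fl0; rewrite eh => fl0; rewrite (Prop_irrelevance fl0 fl).
have := ab (inr (Tagged _ (hf, t) : I)); rewrite /=.
case: pselect => [fl' abt|[]]; last by rewrite -hE.
exact: (transfer _ fl' (esym hE) abt).
Qed.

Lemma universal_closure (S : signature) n (f : formula S n) :
  exists f0 : formula S 0, forall N : structure S,
    sat f0 ([tuple] : 0.-tuple N) <-> forall v : n.-tuple N, sat f v.
Proof.
elim: n f => [|n IH] f.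
  by exists f => N; split=> [s0 v|]; [rewrite (tuple0 v)|apply].
have [f0 f0E] := IH (All f); exists f0 => N; rewrite f0E /=.
split=> sf v; last by move=> x; exact: sf.
by rewrite (tuple_eta v); exact: sf.
Qed.

Theorem proposition3p2p20 (tau : nat -> nat)
    (tau_ge : forall n : nat, (n <= tau n)%N) :
  satisfiable (T_theory tau) -> quantifier_elimination (T_theory tau).
Proof.
move=> _ n f; have [mu pf] := back_and_forth tau f.
have [B HB] := selection mu n; have [k [G [qfG GP]]] := finite_agree n B.
have [|g qfg gP] := @qf_of_finite n k G (fun N _ => satisfies_T tau N)
    (fun N a => sat f a) qfG.
  move=> M N a b [d modM] [e modN] /GP ab fa.
  have [x0 _] := T_model_point modM; have [y0 _] := T_model_point modN.
  have [intM fld _ _] := modM; have [intN fle _ _] := modN.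
  have [X [F [[aX _] iso Fa nd ne]]] :=
    HB M N d e x0 y0 a b intM intN fld fle ab.
  have := pf M N d e X F a modM modN iso nd ne aX fa.
  rewrite (_ : [tuple of map F a] = b)//; apply: eq_from_tnth => i.
  by rewrite tnth_map Fa.
exists g => // N modN v.
(* Universal closures carry implications from [satisfies_T] to all models. *)
have closed (h h' : formula L_EX n) :
    (forall K : structure L_EX, satisfies_T tau K ->
      forall w : n.-tuple K, sat h w -> sat h' w) -> sat h v -> sat h' v.
  move=> hh'; have [s sE] := universal_closure (Imp h h').
  apply: ((sE N).1 _ v); apply: modN => K /hh' K'.
  by apply/sE => w /=; exact: K'.
by split; apply: closed => K modK w; case: (gP K w modK).
Qed.
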